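(* Let $0<\alpha\leq1$, $f\in\Lambda_\alpha(\mathbb{R}^d)$ and let $\omega$ be the normalized surface measure on the unit sphere $\mathbb{S}^{d-1}$ of $\mathbb{R}^d$. Define $$\mathcal{M}_\varepsilon f(x):=\int_\varepsilon^1\int_{\mathbb{S}^{d-1}}[f(x+h\xi)-f(x)]\,d\omega(\xi)\,\frac{dh}{h^{\alpha+1}}.$$ Then there exists a positive constant $C$ depending only on $d$, $\alpha$ and $\|f\|_\alpha$ such that $$\limsup_{\varepsilon\to0}\frac{|\mathcal{M}_\varepsilon f(x)|}{\sqrt{\log(1/\varepsilon)\,\log\log\log(1/\varepsilon)}}\leq C$$ for almost all $x\in\mathbb{R}^d$ (with respect to Lebesgue measure).
   Context: For $0<\alpha<1$, $\Lambda_\alpha(\mathbb{R}^d)$ is the space of functions $f:\mathbb{R}^d\to\mathbb{R}$ with $\|f\|_\alpha:=\sup\frac{|f(x+h)-f(x)|}{|h|^\alpha}<\infty$. For $\alpha=1$, $\Lambda_1(\mathbb{R}^d)$ is the Zygmund class: all continuous functions $f:\mathbb{R}^d\to\mathbb{R}$ with $\|f\|_1:=\sup\frac{|f(x+h)+f(x-h)-2f(x)|}{|h|}<\infty$. Both suprema are over all $x\in\mathbb{R}^d$ and $h\in\mathbb{R}^d\setminus\{0\}$. ''Normalized'' means $\omega(\mathbb{S}^{d-1})=1$. *)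

(* Defs.v *)
From HB Require Import structures.
From mathcomp Require Import all_boot all_order all_algebra.
From mathcomp Require Import all_classical all_reals all_analysis.
From mathcomp Require Import measurable_realfun.

Set Implicit Arguments.
Unset Strict Implicit.
Unset Printing Implicit Defensive.

Import Order.TTheory GRing.Theory Num.Theory.
Import numFieldNormedType.Exports.

Local Open Scope classical_set_scope.
Local Open Scope ring_scope.

(* R^n is 'rV[R]_n with the product sigma-algebra, i.e. the one generated by
   the coordinates, as the library does for n.-tuple T. *)
Definition measure_rV_display : measure_display -> measure_display.
Proof. exact. Qed.

Section measurable_rV.
Context {d} {T : sigmaRingType d}.
Variable n : nat.

Let coors : 'I_n -> 'rV[T]_n -> T := fun i v => v ord0 i.

Let rV_set0 : g_sigma_preimage coors set0.
Proof. exact: sigma_algebra0. Qed.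

Let rV_setC A : g_sigma_preimage coors A -> g_sigma_preimage coors (~` A).
Proof. exact: sigma_algebraC. Qed.

Let rV_bigcup (F : _^nat) : (forall i, g_sigma_preimage coors (F i)) ->
  g_sigma_preimage coors (\bigcup_i (F i)).
Proof. exact: sigma_algebra_bigcup. Qed.

HB.instance Definition _ := @isMeasurable.Build (measure_rV_display d)
  'rV[T]_n (g_sigma_preimage coors) rV_set0 rV_setC rV_bigcup.

End measurable_rV.

Section measurable_rV_lemmas.
Context d1 d2 (T1 : measurableType d1) (T2 : measurableType d2).

Lemma measurable_coord n (i : 'I_n) :
  measurable_fun [set: 'rV[T2]_n] (fun v : 'rV[T2]_n => v ord0 i).
Proof.
move=> _ Y mY; rewrite setTI; apply: sub_sigma_algebra => /=.
rewrite -bigcup_seq/=; exists i => /=; first by rewrite mem_index_enum.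
by exists Y => //; rewrite setTI.
Qed.

Lemma measurable_fun_coordP n (f : T1 -> 'rV[T2]_n) :
  measurable_fun [set: T1] f <->
  forall i, measurable_fun [set: T1] (fun x => f x ord0 i).
Proof.
split=> [mf i|mf].
  exact: (measurableT_comp (measurable_coord i) mf).
apply: (measurability (\big[setU/set0]_(i < n)
  preimage_set_system setT (fun v : 'rV[T2]_n => v ord0 i) measurable)) => //.
move=> _ [B GB <-].
move: GB; rewrite -bigcup_seq/= => -[i _ [A mA <-]].
by rewrite !setTI; have := mf i measurableT A mA; rewrite setTI.
Qed.

End measurable_rV_lemmas.

Section lebesgue_rV.
Context {R : realType}.

Definition rV_cons n (p : measurableTypeR R * 'rV[R]_n) : 'rV[R]_n.+1 :=
  \row_(i < n.+1) if unlift ord0 i is Some j then p.2 ord0 j else p.1.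

Definition rV_uncons n (v : 'rV[R]_n.+1) : measurableTypeR R * 'rV[R]_n :=
  (v ord0 ord0, \row_(i < n) v ord0 (lift ord0 i)).

Lemma rV_consK n : cancel (@rV_cons n) (@rV_uncons n).
Proof.
move=> [x v]; rewrite /rV_uncons /rV_cons !mxE unlift_none; congr pair.
by apply/rowP => i; rewrite !mxE liftK.
Qed.

Lemma rV_unconsK n : cancel (@rV_uncons n) (@rV_cons n).
Proof.
move=> v; apply/rowP => i; rewrite !mxE.
by case: unliftP => [j|] -> /=; rewrite ?mxE.
Qed.

Lemma measurable_rV_cons n : measurable_fun [set: measurableTypeR R * 'rV[R]_n] (@rV_cons n).
Proof.
apply/measurable_fun_coordP => i.
rewrite (_ : (fun x => _) = (fun x : measurableTypeR R * 'rV[R]_n =>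
  if unlift ord0 i is Some j then x.2 ord0 j else x.1)); last first.
  by apply/funext => x; rewrite mxE.
case: unliftP => [j|] _; last exact: measurable_fst.
exact: (measurableT_comp (measurable_coord j) measurable_snd).
Qed.

Lemma measurable_rV_uncons n : measurable_fun [set: 'rV[R]_n.+1] (@rV_uncons n).
Proof.
apply: measurable_fun_pair; first exact: measurable_coord.
apply/measurable_fun_coordP => i.
rewrite (_ : (fun x => _) = (fun x : 'rV[R]_n.+1 => x ord0 (lift ord0 i))).
  exact: measurable_coord.
by apply/funext => x; rewrite mxE.
Qed.

Section succ.
Variables (n : nat) (mu : {sigma_finite_measure set 'rV[R]_n -> \bar R}).

Definition lebesgue_rV_succ : set 'rV[R]_n.+1 -> \bar R :=
  pushforward (lebesgue_measure \x mu)%E (@rV_cons n).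

Let lebesgue_rV_succ0 : lebesgue_rV_succ set0 = 0%E.
Proof. by rewrite /lebesgue_rV_succ /pushforward preimage_set0 measure0. Qed.

Let lebesgue_rV_succ_ge0 A : (0 <= lebesgue_rV_succ A)%E.
Proof. by rewrite /lebesgue_rV_succ /pushforward measure_ge0. Qed.

Let lebesgue_rV_succ_sigma_additive : semi_sigma_additive lebesgue_rV_succ.
Proof.
exact: (@measure_semi_sigma_additive _ _ _
  (measure_function_pushforward__canonical__measure_function_Measure _
    (@measurable_rV_cons n))).
Qed.

HB.instance Definition _ := isMeasure.Build _ _ _ lebesgue_rV_succ
  lebesgue_rV_succ0 lebesgue_rV_succ_ge0 lebesgue_rV_succ_sigma_additive.

Let sigma_finite_succ : sigma_finite setT lebesgue_rV_succ.
Proof.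
have /sigma_finiteP[F [TF ndF Foo]] :=
  sigma_finiteT (@lebesgue_measure R : {sigma_finite_measure set _ -> \bar R}).
have /sigma_finiteP[G [TG ndG Goo]] := sigma_finiteT mu.
exists (fun k => @rV_uncons n @^-1` (F k `*` G k)).
  apply/esym; rewrite -subTset => v _ /=.
  have [i _ Fi] : (\bigcup_k F k) (v ord0 ord0) by rewrite -TF.
  have [j _ Gj] : (\bigcup_k G k) (rV_uncons v).2 by rewrite -TG.
  exists (maxn i j) => //; split => /=.
    by move: Fi; exact/subsetPset/ndF/leq_maxl.
  by move: Gj; exact/subsetPset/ndG/leq_maxr.
move=> k; have [mF Fk] := Foo k; have [mG Gk] := Goo k; split.
  rewrite -[X in measurable X]setTI; apply: measurable_rV_uncons => //.
  exact: measurableX.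
rewrite /lebesgue_rV_succ /pushforward -comp_preimage.
rewrite (_ : _ \o _ = id) ?preimage_id//.
  by rewrite product_measure1E// lte_mul_pinfty// ge0_fin_numE.
by apply/funext => p /=; rewrite rV_consK.
Qed.

HB.instance Definition _ := Measure_isSigmaFinite.Build _ _ _
  lebesgue_rV_succ sigma_finite_succ.

End succ.

Fixpoint lebesgue_rV n : {sigma_finite_measure set 'rV[R]_n -> \bar R} :=
  match n with
  | 0%N => \d_(0 : 'rV[R]_0)
  | m.+1 => lebesgue_rV_succ (lebesgue_rV m)
  end.


Lemma measurable_box n (A : 'I_n -> set R) : (forall i, measurable (A i)) ->
  measurable [set v : 'rV[R]_n | forall i, A i (v ord0 i)].
Proof.
move=> mA; rewrite (_ : mkset _ =
    \bigcap_(i in [set: 'I_n]) ((fun v : 'rV[R]_n => v ord0 i) @^-1` A i)).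
  apply: fin_bigcap_measurable => // i _.
  by rewrite -[X in measurable X]setTI; exact: measurable_coord.
by apply/seteqP; split=> v /= Av i; [move=> _|]; exact: Av.
Qed.

Lemma lebesgue_rV_box n (A : 'I_n -> set R) : (forall i, measurable (A i)) ->
  lebesgue_rV n [set v : 'rV[R]_n | forall i, A i (v ord0 i)] =
  (\prod_(i < n) lebesgue_measure (A i))%E.
Proof.
elim: n => [|n IHn] in A * => mA.
  by rewrite big_ord0 /= diracE mem_set// => -[].
rewrite big_ord_recl/= /lebesgue_rV_succ /pushforward.
have -> : @rV_cons n @^-1` [set v : 'rV[R]_n.+1 | forall i, A i (v ord0 i)] =
    A ord0 `*` [set v : 'rV[R]_n | forall i, A (lift ord0 i) (v ord0 i)].
  apply/seteqP; split => -[x v] /=.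
    move=> Av; split=> [|i].
      by have := Av ord0; rewrite mxE unlift_none.
    by have := Av (lift ord0 i); rewrite mxE liftK.
  by move=> [/= Ax Av] i; rewrite mxE; case: unliftP => [j|] ->.
rewrite product_measure1E//; first by congr (_ * _)%E; exact: (IHn (fun i => A (lift ord0 i))).
  exact: mA.
by apply: (@measurable_box _ (fun i => A (lift ord0 i))) => i; exact: mA.
Qed.

End lebesgue_rV.

Section sphere.
Context {R : realType}.
Variable n : nat.
Implicit Types x : 'rV[R]_n.

(* The canonical norm `|x| of 'rV[R]_n is the sup norm. *)
Definition enorm x : R := Num.sqrt (\sum_(i < n) x ord0 i ^+ 2).

Definition sphere : set 'rV[R]_n := [set x | enorm x = 1].

Definition punctured_ball : set 'rV[R]_n := [set x | 0 < enorm x <= 1].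

Definition radial x : 'rV[R]_n := (enorm x)^-1 *: x.

Lemma measurable_enorm : measurable_fun [set: 'rV[R]_n] enorm.
Proof.
apply: measurableT_comp.
  by apply: continuous_measurable_fun; exact: sqrt_continuous.
apply: measurable_sum => i; apply: measurable_funX; exact: measurable_coord.
Qed.

Lemma measurable_punctured_ball : measurable punctured_ball.
Proof.
rewrite (_ : punctured_ball = enorm @^-1` `]0, 1]).
  by rewrite -[X in measurable X]setTI; exact: measurable_enorm.
by apply/seteqP; split => x /=; rewrite in_itv.
Qed.

Lemma measurable_radial : measurable_fun [set: 'rV[R]_n] radial.
Proof.
apply/measurable_fun_coordP => i.
rewrite (_ : (fun x => _) = (fun x => enorm x `^ (-1) * x ord0 i)); last first.
  by apply/funext => x; rewrite mxE powR_inv1// sqrtr_ge0.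
  apply: measurable_funM; last exact: measurable_coord.
exact: (measurableT_comp (measurable_powR _) measurable_enorm).
Qed.

Definition cone_measure : set 'rV[R]_n -> \bar R :=
  pushforward (mrestr (lebesgue_rV n) measurable_punctured_ball) radial.

Let cone_measure0 : cone_measure set0 = 0%E.
Proof. by rewrite /cone_measure /pushforward preimage_set0 measure0. Qed.

Let cone_measure_ge0 A : (0 <= cone_measure A)%E.
Proof. by rewrite /cone_measure /pushforward measure_ge0. Qed.

Let cone_measure_sigma_additive : semi_sigma_additive cone_measure.
Proof.
exact: (@measure_semi_sigma_additive _ _ _
  (measure_function_pushforward__canonical__measure_function_Measure _
    measurable_radial)).
Qed.

HB.instance Definition _ := isMeasure.Build _ _ _ cone_measure
  cone_measure0 cone_measure_ge0 cone_measure_sigma_additive.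

(* The surface measure of the unit sphere given by polar coordinates:
   sigma A = n * |{r xi : 0 < r <= 1, xi \in A}| for A included in the sphere,
   seen as a measure on R^n concentrated on the sphere; for n = 1 it is the
   counting measure on {-1, 1}. *)
Definition surface_measure : set 'rV[R]_n -> \bar R :=
  mscale (NngNum (ler0n R n)) cone_measure.

HB.instance Definition _ := Measure.on surface_measure.

Definition cone (A : set 'rV[R]_n) : set 'rV[R]_n :=
  [set x | 0 < enorm x <= 1 /\ A ((enorm x)^-1 *: x)].

Lemma surface_measureE A :
  surface_measure A = (n%:R%:E * lebesgue_rV n (cone A))%E.
Proof.
congr (_ * lebesgue_rV n _)%E.
by apply/seteqP; split => x [] ? ?; split.
Qed.

Lemma enorm_coord x i : `|x ord0 i| <= enorm x.
Proof.
rewrite -sqrtr_sqr ler_wsqrtr// (bigD1 i)//= lerDl.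
by apply: sumr_ge0 => j _; exact: sqr_ge0.
Qed.

Lemma cone_setT : cone [set: 'rV[R]_n] = punctured_ball.
Proof. by apply/seteqP; split=> x /=; [case|]. Qed.

Lemma cone_sphere : cone sphere = punctured_ball.
Proof.
apply/seteqP; split=> x /=; first by case.
move=> x01; have /andP[x0 _] := x01; split=> //; rewrite /sphere /= /enorm.
under eq_bigr do rewrite mxE exprMn.
rewrite -mulr_sumr sqrtrM ?sqr_ge0// sqrtr_sqr ger0_norm ?invr_ge0 ?sqrtr_ge0//.
by rewrite mulVf// gt_eqF.
Qed.

Lemma lebesgue_punctured_ball_fin : (lebesgue_rV n punctured_ball < +oo)%E.
Proof.
apply: (@le_lt_trans _ _ (lebesgue_rV n
    [set v : 'rV[R]_n | forall i, `[-1, 1]%classic (v ord0 i)])).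
  apply: le_measure.
  - by rewrite inE; exact: measurable_punctured_ball.
  - by rewrite inE; apply: (@measurable_box _ n (fun=> `[-1, 1]%classic)).
  - move=> x /= /andP[_ x1] i; rewrite in_itv/= -ler_norml.
    exact: le_trans (enorm_coord x i) x1.
rewrite (@lebesgue_rV_box _ n (fun=> `[-1, 1]%classic))// ltey_eq.
by rewrite prode_fin_num// => i _; rewrite lebesgue_measure_itv/=; case: ifP.
Qed.

Lemma lebesgue_punctured_ball_gt0 : (0 < n)%N ->
  (0 < lebesgue_rV n punctured_ball)%E.
Proof.
move=> n0; pose A : set R := `]0, n%:R^-1]%classic.
have mA (i : 'I_n) : measurable A by exact: measurable_itv.
have n0' : 0 < n%:R^-1 :> R by rewrite invr_gt0 ltr0n.
apply: (@lt_le_trans _ _ (lebesgue_rV n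
    [set v : 'rV[R]_n | forall i, A (v ord0 i)])).
  rewrite (@lebesgue_rV_box _ n (fun=> A))//.
  rewrite (eq_bigr (fun=> n%:R^-1%:E)); last first.
    by move=> i _; rewrite lebesgue_measure_itv/= lte_fin n0' sube0.
  by elim/big_ind : _ => // x y x0 y0; exact: mule_gt0.
apply: le_measure.
- by rewrite inE; apply: (@measurable_box _ n (fun=> A)).
- by rewrite inE; exact: measurable_punctured_ball.
move=> x /= Ax.
have A0 i : 0 < x ord0 i <= n%:R^-1 by have := Ax i; rewrite /A /= in_itv.
apply/andP; split.
  have /andP[xi0 _] := A0 (Ordinal n0).
  by rewrite (lt_le_trans _ (enorm_coord x (Ordinal n0)))// normr_gt0 gt_eqF.
rewrite -[leRHS]sqrtr1 ler_wsqrtr//.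
apply: (@le_trans _ _ (\sum_(i < n) n%:R^-1)).
  apply: ler_sum => i _; have /andP[xi0 xin] := A0 i.
  rewrite expr2; apply: le_trans (ler_pM (ltW xi0) (ltW xi0) xin xin) _.
  by rewrite ler_piMr ?(ltW n0')// invf_le1 ?ltr0n// ler1n.
by rewrite sumr_const card_ord -[leLHS]mulr_natl mulfV// pnatr_eq0 -lt0n.
Qed.

(* The Dirac mass is only used by mnormalize when the total mass is 0 or +oo,
   which does not happen for 0 < n, see omegaE. *)
Definition omega : probability 'rV[R]_n R :=
  mnormalize surface_measure \d_(0 : 'rV[R]_n).

Lemma omegaE A : (0 < n)%N ->
  omega A = (surface_measure A * (fine (surface_measure sphere))^-1%:E)%E.
Proof.
move=> n0; rewrite /omega /= /mnormalize/=.
have -> : surface_measure [set: 'rV[R]_n] = surface_measure sphere.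
  by rewrite !surface_measureE cone_setT cone_sphere.
rewrite ifF// !surface_measureE cone_sphere.
have b0 := lebesgue_punctured_ball_gt0 n0.
rewrite gt_eqF/=; last by rewrite mule_gt0// lte_fin ltr0n.
by rewrite lt_eqF// lte_mul_pinfty// ?lee_fin ?ltry// lebesgue_punctured_ball_fin.
Qed.

Lemma omega_sphere : (0 < n)%N -> omega sphere = 1%E.
Proof.
move=> n0; rewrite omegaE//.
have s0 : (0 < surface_measure sphere)%E.
  rewrite surface_measureE cone_sphere mule_gt0// ?lte_fin ?ltr0n//.
  exact: lebesgue_punctured_ball_gt0.
have soo : (surface_measure sphere < +oo)%E.
  rewrite surface_measureE cone_sphere lte_mul_pinfty// ?lee_fin//.
  exact: lebesgue_punctured_ball_fin.
have sfin : surface_measure sphere \is a fin_num by rewrite ge0_fin_numE// ltW.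
rewrite -[X in (X * _)%E](fineK sfin) -EFinM mulfV//.
by rewrite gt_eqF// fine_gt0// s0 soo.
Qed.

End sphere.
Arguments sphere {R} n.
Arguments omega {R} n.

Section corollary.
Context {R : realType}.
Variable d : nat.
Implicit Types (alpha : R) (f : 'rV[R]_d -> R).
Local Open Scope ereal_scope.

Definition holder_seminorm alpha f : \bar R :=
  ereal_sup [set ((`|f (x + h) - f x| / enorm h `^ alpha)%R)%:E
    | x in [set: 'rV[R]_d] & h in [set h | h != 0%R]].

Definition zygmund_seminorm f : \bar R :=
  ereal_sup [set ((`|f (x + h) + f (x - h) - 2 * f x| / enorm h)%R)%:E
    | x in [set: 'rV[R]_d] & h in [set h | h != 0%R]].

Definition Lambda_seminorm alpha f : \bar R :=
  if alpha == 1%R then zygmund_seminorm f else holder_seminorm alpha f.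

Definition Lambda alpha : set ('rV[R]_d -> R) :=
  [set f | (alpha = 1%R -> continuous f) /\ Lambda_seminorm alpha f < +oo].

Definition M_eps alpha (eps : R) f (x : 'rV[R]_d) : R :=
  (\int[lebesgue_measure]_(h in `[eps, 1%R])
    ((\int[omega d]_(xi in sphere d) (f (x + h *: xi) - f x)) /
      h `^ (alpha + 1)))%R.

End corollary.

(* Main.v *)
Require Import Defs.
From HB Require Import structures.
From mathcomp Require Import all_boot all_order all_algebra.
From mathcomp Require Import all_classical all_reals all_analysis.
From mathcomp Require Import measurable_realfun ring lra zify.

Set Implicit Arguments.
Unset Strict Implicit.
Unset Printing Implicit Defensive.

Import Order.TTheory GRing.Theory Num.Theory.
Import numFieldNormedType.Exports.

Local Open Scope classical_set_scope.
Local Open Scope ring_scope.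

(** Write D_v f(x) = f(x+v) + f(x-v) - 2 f(x).  Because the surface measure is
    symmetric, the spherical average of f(x + h xi) - f(x) is half the average
    of D_(h xi) f(x), and for every alpha in ]0, 1] membership in Lambda_alpha
    gives |D_v f| <= B |v|^alpha.  Hence the piece of the truncated operator
    that comes from a dyadic range [2^-(j+1), 2^-j] of radii is bounded, and the
    truncation at 2^-n is a sum of n bounded functions u_j.  The theorem says that
    these functions add up like independent ones.

    Two facts make them do so.  Regularity: u_j varies by at most about
    (m+1) 2^(-m alpha) over distances 2^-(j+m).  Cancellation: the mean of u_j over a
    dyadic cube of side 2^-k, k <= j, is of order (j-k+1) 2^-(j-k), since
    translating the cube by v only changes a boundary layer.  Both rest on one estimate,
    mixed_diff_le, for f(x+w+t) - f(x+w) - f(x+t) + f(x) when t is much shorter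
    than w; it follows from the second difference bound by doubling t.  Summing
    over scales, the truncation at scale 2^-k stays within a constant of the
    average over its dyadic cube of side 2^-k of the truncation at a much finer
    scale 2^-T (grid_martingale_approx), and those averages form a martingale in
    k with bounded increments.

    The cube averages are taken over the points of the lattice of mesh 2^-T
    rather than with respect to Lebesgue measure.  The price is that v must be
    rounded to a lattice vector, which the regularity estimate absorbs; the gain
    is that averages are finite sums, so that they commute with the integrals in
    h and xi, translation of a cube is a statement about finite sets of
    integers, and the martingale lives on a finite set.  An exponential maximal
    inequality (class_avg_maximal), proved by induction on the number of
    generations, then shows that the lattice cells where the martingale exceeds
    a constant times sqrt(2^j ln j) at some time k <= 2^j have total measure
    O(j^-2) in a bounded cube.  By Borel-Cantelli almost every point avoids them
    for all large j (ae_block_bound).  For 2^(j-1) <= n < 2^j and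
    2^-(n+1) <= eps <= 2^-n, the quantities 2^j ln j and
    ln(1/eps) ln ln ln(1/eps) are comparable, which gives the limsup bound. *)

(** * Second differences at dyadic scales *)

Lemma continuous_of_modulus {R : realType} {V : normedModType R} (f : V -> R) :
  (forall x e, 0 < e -> exists2 delta, 0 < delta &
     forall y, `|x - y| <= delta -> `|f x - f y| <= e) -> continuous f.
Proof.
move=> H x; apply/cvgrPdist_le => e /(H x)[delta delta0 fd].
apply/nbhs_ballP; exists delta => //= y.
by rewrite -ball_normE /= => /ltW; exact: fd.
Qed.

Section second_differences.
Context {R : realType} {V : normedModType R}.
Implicit Types (f : V -> R) (x v w t h : V).

Definition second_diff f v x : R := f (x + v) + f (x - v) - 2 * f x.

Definition mixed_diff f x w t : R := f (x + w + t) - f (x + w) - f (x + t) + f x.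

(** The Zygmund condition of order alpha with r = 2^-alpha.  The factor 4 leaves
    room for sums of a few vectors of length 2^-n. *)
Definition dyadic_zygmund f (B r : R) := forall n x h,
  `|h| <= 4 * 2 ^- n -> `|second_diff f h x| <= B * r ^+ n.

Lemma continuous_along f x (s : R) : continuous f ->
  continuous (fun v => f (x + s *: v)).
Proof.
move=> cf v; apply: (@continuous_comp _ _ _ (fun v => x + s *: v) f); last exact: cf.
by apply: cvgD; [exact: cvg_cst|exact: scaler_continuous].
Qed.

Lemma continuous_increment f x (s : R) : continuous f ->
  continuous (fun v => f (x + s *: v) - f x).
Proof.
by move=> cf v; apply: cvgB; [exact: continuous_along|exact: cvg_cst].
Qed.

Lemma continuous_second_diff f x (s : R) : continuous f ->
  continuous (fun v => second_diff f (s *: v) x).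
Proof.
move=> cf v; apply: cvgB; last exact: cvg_cst.
apply: cvgD; first exact: continuous_along.
by under eq_fun do rewrite -scaleNr; rewrite -scaleNr; exact: continuous_along.
Qed.

(** Both diagonals of a parallelogram have the same midpoint. *)
Lemma mixed_diff_parallelogram f x w t : mixed_diff f x w t =
  second_diff f (2^-1 *: (w + t)) (x + 2^-1 *: (w + t)) -
  second_diff f (2^-1 *: (w - t)) (x + 2^-1 *: (w + t)).
Proof.
have half (a : V) : a = 2^-1 *: a + 2^-1 *: a by rewrite -scalerDl -[LHS]scale1r; congr (_ *: _); lra.
rewrite /mixed_diff /second_diff.
have -> : x + 2^-1 *: (w + t) + 2^-1 *: (w + t) = x + w + t.
  by rewrite -!addrA -half.
have -> : x + 2^-1 *: (w + t) + 2^-1 *: (w - t) = x + w.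
  by rewrite -addrA -scalerDr addrACA subrr addr0 scalerDr -half.
have -> : x + 2^-1 *: (w + t) - 2^-1 *: (w - t) = x + t.
  by rewrite -addrA -scalerBr opprB addrC [w + t + _]addrC subrKA scalerDr -half addrC.
by rewrite addrK; ring.
Qed.

Lemma mixed_diff_double f x w t :
  mixed_diff f x w (t + t) - 2 * mixed_diff f x w t =
  second_diff f t (x + w + t) - second_diff f t (x + t).
Proof. by rewrite /mixed_diff /second_diff !addrA !addrK; ring. Qed.

Variables (f : V -> R) (B r : R).
Hypotheses (B0 : 0 <= B) (r12 : 2^-1 <= r) (fB : dyadic_zygmund f B r).

(** The four points are the vertices of a parallelogram, which bounds the mixed
    difference when t and w have comparable length.  For shorter t, halving t
    halves the mixed difference up to second differences in direction t; as
    r >= 1/2, each of the m halvings costs one more term of size r^(n+m). *)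
Lemma mixed_diff_le n m x w t :
  `|w| <= 4 * 2 ^- n -> `|t| <= 4 * 2 ^- (n + m) ->
  `|mixed_diff f x w t| <= 2 * B * (m.+1)%:R * r ^+ (n + m).
Proof.
have r0 : 0 <= r by apply: le_trans r12; rewrite invr_ge0.
move=> wn; elim: m t => [|m IH] t tm.
  rewrite addn0 in tm *; rewrite mixed_diff_parallelogram.
  have half (a : V) : `|a| <= 4 * 2 ^- n + 4 * 2 ^- n -> `|2^-1 *: a| <= 4 * 2 ^- n.
    by rewrite normrZ ger0_norm ?invr_ge0// => ?; lra.
  apply: (le_trans (ler_normB _ _)).
  have -> : 2 * B * 1 * r ^+ n = B * r ^+ n + B * r ^+ n by ring.
  apply: lerD; apply: fB; apply: half.
    by apply: (le_trans (ler_normD _ _)); exact: lerD.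
  by apply: (le_trans (ler_normB _ _)); exact: lerD.
have t2 : `|t + t| <= 4 * 2 ^- (n + m).
  apply: (le_trans (ler_normD _ _)); move: tm.
  by rewrite addnS exprS invfM; lra.
have D := mixed_diff_double f x w t.
have D1 := IH _ t2.
have D2 := fB (x + w + t) tm.
have D3 := fB (x + t) tm.
have H : 0 <= B * (r ^+ (n + m)) * (r - 2^-1) * (m.+1)%:R.
  by rewrite !mulr_ge0// ?exprn_ge0// subr_ge0.
have H2 : 0 <= B * r ^+ (n + m.+1) by rewrite mulr_ge0// exprn_ge0.
have E : r ^+ (n + m.+1) = r * r ^+ (n + m) by rewrite addnS exprS.
have M : (m.+2)%:R = (m.+1)%:R + 1 :> R by rewrite -natr1.
have -> : mixed_diff f x w t = 2^-1 * (mixed_diff f x w (t + t) -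
  (second_diff f t (x + w + t) - second_diff f t (x + t))) by rewrite -D; lra.
rewrite normrM ger0_norm ?invr_ge0//.
have := le_trans (ler_normB (mixed_diff f x w (t + t)) (second_diff f t (x + w + t) - second_diff f t (x + t)))
   (lerD D1 (le_trans (ler_normB _ _) (lerD D2 D3))).
move: H H2; rewrite M E; nra.
Qed.

(** Regularity in the base point, at a scale m generations finer than v. *)
Lemma second_diff_shift_le n m x v t :
  `|v| <= 4 * 2 ^- n -> `|t| <= 4 * 2 ^- (n + m) ->
  `|second_diff f v (x + t) - second_diff f v x| <=
  4 * B * (m.+1)%:R * r ^+ (n + m).
Proof.
move=> vn tm.
have -> : second_diff f v (x + t) - second_diff f v x =
    mixed_diff f x v t + mixed_diff f x (- v) t.
  rewrite /second_diff /mixed_diff [x + t + v]addrAC [x + t - v]addrAC; ring.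
apply: (le_trans (ler_normD _ _)).
have := mixed_diff_le x vn tm; have vn' : `|- v| <= 4 * 2 ^- n by rewrite normrN.
by have := mixed_diff_le x vn' tm; lra.
Qed.

(** Regularity in the step; it allows one to round v to a lattice vector. *)
Lemma second_diff_step_le n m x v w :
  `|v + w| <= 4 * 2 ^- n -> `|v - w| <= 4 * 2 ^- (n + m) ->
  `|second_diff f v x - second_diff f w x| <=
  2 * B * (m.+1)%:R * r ^+ (n + m).
Proof.
move=> vn tm.
have -> : second_diff f v x - second_diff f w x = mixed_diff f (x - v) (v + w) (v - w).
  rewrite /second_diff /mixed_diff.
  have -> : x - v + (v + w) = x + w by rewrite subrKA.
  have -> : x + w + (v - w) = x + v by rewrite addrC [x + w]addrC subrKA addrC.
  have -> : x - v + (v - w) = x - w by rewrite subrKA.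
  by ring.
exact: mixed_diff_le.
Qed.

End second_differences.

(** * Lebesgue measure and continuous functions on row vectors *)

Section reflection.
Context {R : realType}.

Lemma measurable_rV_opp n :
  measurable_fun [set: 'rV[R]_n] (fun v : 'rV[R]_n => - v).
Proof.
apply/measurable_fun_coordP => i.
rewrite (_ : (fun x => _) = (fun x : 'rV[R]_n => - x ord0 i)); last first.
  by apply/funext => x; rewrite mxE.
exact: measurableT_comp (measurable_coord i).
Qed.

Lemma lebesgue_rV_succE n (A : set 'rV[R]_n.+1) : lebesgue_rV n.+1 A =
  (lebesgue_measure \x lebesgue_rV n)%E (@rV_cons R n @^-1` A).
Proof. by []. Qed.

(** By induction on the dimension: the image of the product measure under the
    reflection agrees with it on rectangles. *)
Lemma lebesgue_rV_opp n (A : set 'rV[R]_n) : measurable A ->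
  lebesgue_rV n ((fun v => - v) @^-1` A) = lebesgue_rV n A.
Proof.
elim: n => [|n IH] in A * => mA.
  by rewrite /= !diracE; congr ((_ _)%:R%:E); apply/idP/idP; rewrite !inE /= oppr0.
pose neg (p : measurableTypeR R * 'rV[R]_n) := (- p.1 : measurableTypeR R, - p.2).
have mneg : measurable_fun setT neg.
  apply: measurable_fun_pair.
    by apply: (@measurableT_comp _ _ _ _ _ _ (-%R : R -> R)) => //; exact: measurable_fst.
  exact: (measurableT_comp (@measurable_rV_opp n) measurable_snd).
have mcA : measurable (@rV_cons R n @^-1` A).
  by rewrite -[X in measurable X]setTI; exact: measurable_rV_cons.
rewrite !lebesgue_rV_succE.
have -> : @rV_cons R n @^-1` ((fun v => - v) @^-1` A) = neg @^-1` (@rV_cons R n @^-1` A).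
  apply/funext => -[x v]; rewrite /preimage /=; congr A.
  by apply/rowP => i; rewrite !mxE; case: unlift => //= j; rewrite mxE.
pose m' : {measure set _ -> \bar R} :=
  measure_function_pushforward__canonical__measure_function_Measure
   (lebesgue_measure \x lebesgue_rV n)%E mneg.
apply/esym; apply: (@product_measure_unique _ _ _ _ _ lebesgue_measure (lebesgue_rV n) m' _ _ mcA) => X Y mX mY.
have -> : m' (X `*` Y) = (lebesgue_measure \x lebesgue_rV n)%E ((-%R @^-1` X) `*` ((fun v => - v) @^-1` Y)) by [].
rewrite product_measure1E//.
- by rewrite IH//; congr (_ * _)%E; exact: lebesgue_measureN.
- by rewrite -[X in measurable X]setTI; exact: oppr_measurable.
- by rewrite -[X in measurable X]setTI; exact: measurable_rV_opp.
Qed.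

Lemma enorm_opp n (x : 'rV[R]_n) : enorm (- x) = enorm x.
Proof.
by congr Num.sqrt; apply: eq_bigr => i _; rewrite mxE sqrrN.
Qed.

Lemma omega_opp n (A : set 'rV[R]_n) : (0 < n)%N -> measurable A ->
  omega n ((fun v => - v) @^-1` A) = omega n A.
Proof.
move=> n0 mA; rewrite !omegaE// !surface_measureE; congr (_ * _ * _)%E.
have mcone : measurable (cone A).
  rewrite (_ : cone A = @punctured_ball R n `&` (@radial R n @^-1` A))//.
  apply: measurableI; first exact: measurable_punctured_ball.
  by rewrite -[X in measurable X]setTI; exact: measurable_radial.
rewrite -[RHS]lebesgue_rV_opp//; congr (lebesgue_rV n _).
by apply/seteqP; split => x /=; rewrite /cone /= enorm_opp scalerN.
Qed.

End reflection.

Section sup_norm.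
Context {R : realType} {d : nat}.
Implicit Types x : 'rV[R]_d.

Lemma rV_norm_le x e : 0 <= e -> (forall i, `|x ord0 i| <= e) -> `|x| <= e.
Proof.
move=> e0 xe; rewrite /Num.norm /= mx_normrE; apply/bigmax_leP; split => // -[a i] _ /=.
by rewrite ord1.
Qed.

Lemma coord_le_rV_norm x i : `|x ord0 i| <= `|x|.
Proof.
rewrite [X in _ <= X]/Num.norm /= mx_normrE.
exact: (le_bigmax _ (fun ij => `|x ij.1 ij.2|) (ord0, i)).
Qed.

End sup_norm.

Section grid.
Context {R : realType}.
Variables (d N : nat) (s delta : R).
Hypothesis delta0 : 0 < delta.
Implicit Types y : {ffun 'I_d -> 'I_N}.

(** Cells are half open, so that they tile the cube. *)
Definition cell y : set 'rV[R]_d := [set v | forall i,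
  `[s + delta * (y i)%:R, s + delta * (y i).+1%:R[%classic (v ord0 i)].

Definition grid_point y : 'rV[R]_d := \row_i (s + delta * (y i)%:R).

Lemma measurable_cell y : measurable (cell y).
Proof. by apply: (measurable_box (A := fun i => `[_, _[%classic)) => i; exact: measurable_itv. Qed.

Lemma lebesgue_cell y : lebesgue_rV d (cell y) = (delta ^+ d)%:E.
Proof.
rewrite (lebesgue_rV_box (A := fun i => `[_, _[%classic)); last by move=> i; exact: measurable_itv.
rewrite (eq_bigr (fun=> delta%:E)).
  by rewrite prodEFin prodr_const card_ord.
move=> i _; rewrite lebesgue_measure_itv /= lte_fin ltrD2l ltr_pM2l// ltr_nat ltnSn.
by rewrite -EFinD -[X in _ * X]natr1; congr EFin; lra.
Qed.

Lemma cell_ex (v : 'rV[R]_d) :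
  (forall i, s <= v ord0 i < s + delta * N%:R) -> exists y, cell y v.
Proof.
move=> vN.
have tN i : (Num.truncn ((v ord0 i - s) / delta) < N)%N.
  have /andP[v1 v2] := vN i.
  have q0 : 0 <= (v ord0 i - s) / delta by rewrite divr_ge0 ?subr_ge0// ltW.
  rewrite -(ltr_nat R); have /andP[qle _] := truncn_itv q0; apply: le_lt_trans qle _.
  by rewrite ltr_pdivrMr//; lra.
exists [ffun i => Ordinal (tN i)] => i /=; rewrite ffunE /= in_itv /=.
have /andP[v1 _] := vN i.
have q0 : 0 <= (v ord0 i - s) / delta by rewrite divr_ge0 ?subr_ge0// ltW.
have /andP[] := truncn_itv q0.
rewrite ler_pdivlMr// ltr_pdivrMr// => h1 h2; apply/andP; split; lra.
Qed.

Lemma cell_uniq y y' v : cell y v -> cell y' v -> y = y'.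
Proof.
move=> yv y'v; apply/ffunP => i; apply/val_inj/eqP; rewrite eqn_leq.
have := yv i; have := y'v i; rewrite /= !in_itv /= => /andP[a1 a2] /andP[b1 b2].
have := le_lt_trans a1 b2; have := le_lt_trans b1 a2.
by rewrite !ltrD2l !ltr_pM2l// !ltr_nat !ltnS => -> ->.
Qed.

Lemma cell_dist y v : cell y v -> `|v - grid_point y| <= delta.
Proof.
move=> yv; apply: rV_norm_le => [|i]; first exact: ltW.
rewrite !mxE; have := yv i; rewrite /= in_itv /= -natr1 => /andP[h1 h2].
by rewrite ler_norml; lra.
Qed.

End grid.

Section measurability.
Context {R : realType}.
Variable d : nat.
Implicit Types f g : 'rV[R]_d -> R.

(** The sigma-algebra is defined through the coordinates and not through the open
    sets; a continuous function is the limit of the step functions that take its value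
    at the corner of each cell of side 2^-k in the cube [-k, k[^d. *)
Lemma continuous_rV_measurable f : continuous f -> measurable_fun [set: 'rV[R]_d] f.
Proof.
move=> cf.
pose del k : R := 2 ^- k.
have del0 k : 0 < del k by rewrite invr_gt0 exprn_gt0.
pose fk k v := \sum_(y : {ffun 'I_d -> 'I_(2 * k * 2 ^ k)})
  f (grid_point (- k%:R) (del k) y) * \1_(cell (- k%:R) (del k) y) v.
apply: (@measurable_fun_cvg _ _ _ setT fk) => [k|v _].
  apply: measurable_sum => y; apply: measurable_funM => //.
  by apply: measurable_indic; exact: measurable_cell.
apply/cvgrPdist_lt => e e0.
have /cvgrPdist_lt /(_ e e0) := cf v.
move=> /nbhs_ballP [eta /= eta0 Heta].
have [k1 Hk1] : exists k : nat, 2 ^- k < eta.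
  exists (Num.truncn eta^-1).+1.
  rewrite invf_plt ?posrE ?exprn_gt0// (lt_trans (truncnS_gt _))//.
  by rewrite -natrX ltr_nat ltn_expl.
have kv := truncnS_gt `|v|.
set k2 := (Num.truncn `|v|).+1 in kv.
near=> k.
have kk1 : (k1 <= k)%N by near: k; exact: nbhs_infty_ge.
have kk2 : (k2 <= k)%N by near: k; exact: nbhs_infty_ge.
have [i|y yv] := @cell_ex R d (2 * k * 2 ^ k)%N (- k%:R) (del k) (del0 k) v.
  have vi : `|v ord0 i| < k%:R.
    apply: le_lt_trans (lt_le_trans kv _); last by rewrite ler_nat.
    exact: coord_le_rV_norm.
  have -> : - k%:R + del k * (2 * k * 2 ^ k)%:R = k%:R :> R.
    rewrite !natrM natrX mulrCA /del mulVf ?mulr1; last by rewrite expf_neq0// pnatr_eq0.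
    by lra.
  by move: vi; rewrite ltr_norml => /andP[/ltW -> ->].
have -> : fk k v = f (grid_point (- k%:R) (del k) y).
  rewrite /fk (bigD1 y)//= indicE mem_set// mulr1 big1 ?addr0// => y' y'y.
  rewrite indicE memNset ?mulr0// => y'v; move: y'y.
  by rewrite (cell_uniq (del0 k) y'v yv) eqxx.
apply: Heta; rewrite -ball_normE /=.
apply: le_lt_trans (cell_dist (del0 k) yv) (le_lt_trans _ Hk1).
by rewrite lef_pV2 ?posrE ?exprn_gt0// ler_eXn2l// ltr1n.
Unshelve. all: by end_near.
Qed.

End measurability.

(** * Spherical averages *)

Section integral_combination.
Context d0 {T : measurableType d0} {R : realType}.
Variable mu : {measure set T -> \bar R}.

(** Pointwise bounds on a finite linear combination pass to the integrals.  It is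
    the form in which cancellation between different points is carried through
    the integrals over the sphere and over the radius. *)
Lemma Rintegral_combination_le (D : set T) (I : finType) (P : {pred I})
    (c : I -> R) (g : I -> T -> R) (b : R) :
  measurable D -> (mu D < +oo)%E ->
  (forall i, mu.-integrable D (EFin \o g i)) ->
  (forall t, D t -> `|\sum_(i in P) c i * g i t| <= b) ->
  `|\sum_(i in P) c i * \int[mu]_(t in D) g i t| <= b * fine (mu D).
Proof.
move=> mD Dfin gint gb.
have cint i : mu.-integrable D (EFin \o (fun t => c i * g i t)).
  have -> : EFin \o (fun t => c i * g i t) = (fun t => ((c i)%:E * (EFin \o g i) t)%E) by [].
  exact: integrableZl.
have -> : \sum_(i in P) c i * \int[mu]_(t in D) g i t =
    \int[mu]_(t in D) \sum_(i in P) c i * g i t.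
  rewrite /Rintegral; under eq_integral do rewrite -sumEFin.
  rewrite integral_sum// -sum_fine; last first.
    by move=> i _; exact: (integrable_fin_num mD (cint i)).
  by apply: eq_bigr => i _; rewrite -RintegralZl.
have sint : mu.-integrable D (EFin \o (fun t => \sum_(i in P) c i * g i t)).
  have -> : EFin \o (fun t => \sum_(i in P) c i * g i t) =
     (fun t => \sum_(i in P) (EFin \o (fun t => (c i * g i t)%R)) t)%E.
    by apply/funext => t /=; rewrite sumEFin.
  exact: integrable_sum.
apply: (le_trans (le_normr_Rintegral mD sint)).
rewrite -Rintegral_cst//; apply: le_Rintegral => //.
  have -> : EFin \o (fun t => `|\sum_(i in P) c i * g i t|) = (abse \o (EFin \o (fun t => \sum_(i in P) c i * g i t))) by [].
  exact: integrable_abse.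
apply: measurable_bounded_integrable => //.
by exists `|b|; split; rewrite ?num_real// => M bM t _; exact: ltW.
Qed.

End integral_combination.

Section spherical_average.
Context {R : realType}.
Variables (d : nat).
Hypothesis d0 : (0 < d)%N.
Implicit Types (f g : 'rV[R]_d -> R) (x xi : 'rV[R]_d).

Lemma measurable_sphere : measurable (@sphere R d).
Proof.
rewrite (_ : sphere d = @enorm R d @^-1` [set 1])//.
by rewrite -[X in measurable X]setTI; exact: measurable_enorm.
Qed.

Lemma sphere_norm_le1 xi : sphere d xi -> `|xi| <= 1.
Proof.
move=> sxi; apply: rV_norm_le => // i.
by rewrite -sxi enorm_coord.
Qed.

Lemma integrable_omega_sphere g : continuous g ->
  (omega d).-integrable (sphere d) (EFin \o g).
Proof.
move=> cg; apply: measurable_bounded_integrable.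
- exact: measurable_sphere.
- by apply: (@le_lt_trans _ _ 1%E); [exact: (probability_le1 (omega d) measurable_sphere)|exact: ltry].
- by apply: measurable_funTS; apply: continuous_rV_measurable.
pose K : set 'rV[R]_d := closed_ball_ (fun v => `|v|) 0 1.
have cK : compact K.
  apply: bounded_closed_compact; last exact: closed_closed_ball_.
  by exists 1; split; rewrite ?num_real// => M M1 x; rewrite /K /closed_ball_ /= sub0r normrN => /le_trans; apply; exact: ltW.
have /compact_bounded[M [MR HM]] := continuous_compact (continuous_subspaceT cg) cK.
exists M; split => // M' MM' xi sxi; apply: HM => //; exists xi => //=.
by rewrite /K /= /closed_ball_ /= sub0r normrN; exact: sphere_norm_le1.
Qed.

Definition spherical_avg f x (h : R) : R :=
  \int[omega d]_(xi in sphere d) (f (x + h *: xi) - f x).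

(** Average the substitutions xi and - xi. *)
Lemma spherical_avgE f x h : continuous f -> spherical_avg f x h =
  2^-1 * \int[omega d]_(xi in sphere d) second_diff f (h *: xi) x.
Proof.
move=> cf; pose g (s : R) xi := f (x + s *: xi) - f x.
have cg s : continuous (g s).
  by apply: continuous_increment.
have opp : \int[omega d]_(xi in sphere d) g h xi = \int[omega d]_(xi in sphere d) g (- h) xi.
  congr fine.
  pose m1 : {measure set _ -> \bar R} :=
    measure_function_pushforward__canonical__measure_function_Measure
      (omega d) (@measurable_rV_opp R d).
  transitivity (\int[m1]_(xi in sphere d) (g h xi)%:E)%E.
    by apply: eq_measure_integral => A mA _; apply/esym; exact: (omega_opp d0 mA).
  rewrite (@integral_pushforward _ _ _ _ _ _ (@measurable_rV_opp R d)).
  - have -> : (fun v : 'rV[R]_d => - v) @^-1` sphere d = sphere d.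
      by apply/seteqP; split => v; rewrite /sphere /= enorm_opp.
    by apply: eq_integral => xi _ /=; rewrite /g scalerN scaleNr.
  - by apply/measurable_EFinP; apply: continuous_rV_measurable.
  - have -> : (fun v : 'rV[R]_d => - v) @^-1` sphere d = sphere d.
      by apply/seteqP; split => v; rewrite /sphere /= enorm_opp.
    have -> : (EFin \o g h) \o (fun v => - v) = EFin \o g (- h).
      by apply/funext => xi; rewrite /= /g scalerN scaleNr.
    exact: integrable_omega_sphere.
  - exact: measurable_sphere.
have -> : \int[omega d]_(xi in sphere d) second_diff f (h *: xi) x =
   \int[omega d]_(xi in sphere d) (g h xi + g (- h) xi).
  by apply: eq_Rintegral => xi _; rewrite /second_diff /g scaleNr; ring.
rewrite RintegralD; [|exact: measurable_sphere|exact: integrable_omega_sphere..].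
by rewrite -opp -[spherical_avg f x h]/(\int[omega d]_(xi in sphere d) g h xi); lra.
Qed.

Lemma spherical_avg_combination_le f (I : finType) (P : {pred I}) (c h : I -> R)
    (x : I -> 'rV[R]_d) (b : R) : continuous f ->
  (forall xi, `|xi| <= 1 ->
     `|\sum_(i in P) c i * second_diff f (h i *: xi) (x i)| <= b) ->
  `|\sum_(i in P) c i * spherical_avg f (x i) (h i)| <= b.
Proof.
move=> cf sb.
have b0 : 0 <= b by apply: le_trans (sb 0 _); rewrite // normr0.
under eq_bigr do rewrite spherical_avgE// mulrCA.
rewrite -mulr_sumr normrM ger0_norm ?invr_ge0//.
have : `|\sum_(i in P) c i * \int[omega d]_(xi in sphere d) second_diff f (h i *: xi) (x i)|
    <= b * fine (omega d (sphere d)).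
  apply: Rintegral_combination_le => [||i|xi sxi]; first exact: measurable_sphere.
  - by apply: (@le_lt_trans _ _ 1%E); [exact: (probability_le1 (omega d) measurable_sphere)|exact: ltry].
  - by apply: integrable_omega_sphere; apply: continuous_second_diff.
  - by apply: sb; exact: sphere_norm_le1.
rewrite (@omega_sphere R d d0) mulr1; lra.
Qed.

End spherical_average.

(** * The truncated operators as sums over scales *)

Section arithmetic_geometric.
Context {R : realType}.

(** The series sum (m+1) q^m is the square of the geometric series. *)
Lemma arith_geom_sum_le (q : R) n : 0 <= q < 1 ->
  \sum_(m < n) m.+1%:R * q ^+ m <= (1 - q) ^- 2.
Proof.
move=> /andP[q0 q1].
have q1' : 0 < (1 - q) ^+ 2 by rewrite exprn_gt0// subr_gt0.
rewrite -[leRHS]div1r ler_pdivlMr//.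
have -> : (\sum_(m < n) m.+1%:R * q ^+ m) * (1 - q) ^+ 2 =
    1 - q ^+ n - n%:R * q ^+ n * (1 - q).
  elim: n => [|n IH]; first by rewrite big_ord0 expr0; ring.
  rewrite big_ord_recr /= mulrDl IH -natr1 [q ^+ n.+1]exprS; ring.
have : 0 <= n%:R * q ^+ n * (1 - q) by rewrite !mulr_ge0// ?exprn_ge0// subr_ge0 ltW.
have := exprn_ge0 n q0; lra.
Qed.

Lemma cvg_arith_geom (q : R) : 0 <= q < 1 ->
  (fun m : nat => m.+1%:R * q ^+ m : R) @ \oo --> 0.
Proof.
move=> q01; apply: cvg_series_cvg_0.
apply: nondecreasing_is_cvgn.
  apply: nondecreasing_series => n _ _ /=.
  by rewrite mulr_ge0// exprn_ge0//; case/andP: q01.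
exists ((1 - q) ^- 2) => _ [n _ <-].
by rewrite /series /= big_mkord arith_geom_sum_le.
Qed.

End arithmetic_geometric.

Lemma arith_geom_rev_sum_le {R : realType} (q : R) n : 0 <= q < 1 ->
  \sum_(i < n) (n - i).+1%:R * q ^+ (n - i) <= (1 - q) ^- 2.
Proof.
move=> q01; apply: le_trans (arith_geom_sum_le n.+1 q01).
rewrite (reindex_inj rev_ord_inj) /= big_ord_recl /= expr0 mulr1.
rewrite ler_wpDl//; apply: ler_sum => i _ /=.
by rewrite /bump /= add1n subKn.
Qed.

Section truncated_operator.
Context {R : realType}.
Variables (d : nat) (alpha B : R) (f : 'rV[R]_d -> R).
Let r : R := 2^-1 `^ alpha.
Hypotheses (d0 : (0 < d)%N) (alpha_gt0 : 0 < alpha) (alpha_le1 : alpha <= 1).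
Hypotheses (cf : continuous f) (B0 : 0 <= B) (fB : dyadic_zygmund f B r).
Implicit Types (x : 'rV[R]_d).

Lemma half_powR_ge : 2^-1 <= r.
Proof.
rewrite -[leLHS]powRr1 ?invr_ge0// /r; apply: ger_powR => //.
by rewrite invr_gt0 ltr0n /= invf_le1 ?ler1n.
Qed.

Lemma half_powR_lt1 : r < 1.
Proof.
rewrite -[ltRHS]/((fun=> 1) alpha) -(@powR1 R) /r; apply: gt0_ltr_powR; rewrite // ?nnegrE ?invr_ge0//.
by rewrite invf_lt1 ?ltr1n.
Qed.

Lemma half_powR_gt0 : 0 < r. Proof. by rewrite powR_gt0// invr_gt0. Qed.

(** Continuity in the radius makes the outer integrand integrable on [eps, 1]; it
    is again a matter of regularity of D_v f in v. *)
Lemma continuous_spherical_avg x (h : R) : 0 <= h <= 1 ->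
  {for h, continuous (spherical_avg f x)}.
Proof.
move=> /andP[h0 h1]; apply/cvgrPdist_le => e e0.
have r01 : 0 <= r < 1 by rewrite (ltW half_powR_gt0) half_powR_lt1.
have B1 : 0 < 2 * B + 1 by rewrite ltr_wpDl// mulr_ge0.
have /cvgrPdist_lt /(_ (e / (2 * B + 1))) := cvg_arith_geom r01.
rewrite divr_gt0// => /(_ erefl) [m _ /(_ m (leqnn m))] /=.
rewrite sub0r normrN ltr_pdivlMr// => He.
near=> h'.
have hh' : `|h - h'| <= 2 ^- m.
  near: h'; apply: (@cvgr_dist_le _ _ _ _ _ id); first exact: cvg_id.
  by rewrite invr_gt0 exprn_gt0.
have m1 : (2 ^- m : R) <= 1 by rewrite invf_le1 ?exprn_gt0// exprn_ege1// ler1n.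
have h'2 : `|h'| <= 2.
  have : `|h'| <= `|h| + `|h - h'|.
    by rewrite -[X in `|X|](subKr h) (le_trans (ler_normB _ _)).
  by rewrite (ger0_norm h0); lra.
have P := @spherical_avg_combination_le R d d0 f bool predT (fun b => if b then 1 else -1)
  (fun b => if b then h else h') (fun=> x) e cf.
move: P; rewrite (eq_bigl xpredT)// big_bool /= mul1r mulN1r; apply => xi xi1.
rewrite (eq_bigl xpredT)// big_bool /= mul1r mulN1r.
have e1 : `|h *: xi + h' *: xi| <= 4 * 2 ^- 0.
  rewrite -scalerDl normrZ expr0 invr1 mulr1.
  have : `|h + h'| <= 3 by rewrite (le_trans (ler_normD _ _))// (ger0_norm h0); lra.
  have := normr_ge0 (h + h'); have := normr_ge0 xi; nra.
have e2 : `|h *: xi - h' *: xi| <= 4 * 2 ^- (0 + m).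
  rewrite -scalerBl normrZ add0n.
  have := normr_ge0 (h - h'); have := normr_ge0 xi; nra.
apply: (le_trans (second_diff_step_le B0 half_powR_ge fB x e1 e2)).
rewrite add0n; apply: le_trans (ltW He).
rewrite ger0_norm; last by rewrite mulr_ge0// exprn_ge0// ltW// half_powR_gt0.
have : 0 <= m.+1%:R * r ^+ m by rewrite mulr_ge0// exprn_ge0// ltW// half_powR_gt0.
lra.
Unshelve. all: by end_near.
Qed.

Definition kernel x (h : R) : R := spherical_avg f x h / h `^ (alpha + 1).

Lemma M_epsE eps x : M_eps alpha eps f x =
  \int[lebesgue_measure]_(h in `[eps, 1]) kernel x h.
Proof. by []. Qed.

Lemma kernel_integrable a b x : 0 < a -> b <= 1 ->
  lebesgue_measure.-integrable `[a, b] (EFin \o kernel x).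
Proof.
move=> a0 b1; apply: continuous_compact_integrable; first exact: segment_compact.
apply: continuous_in_subspaceT => h; rewrite inE /= in_itv /= => /andP[ah hb].
have h0 : 0 < h by exact: lt_le_trans ah.
have cp : {for h, continuous (fun a : R => a `^ (alpha + 1))}.
  apply: differentiable_continuous; apply/derivable1_diffP/derivable_powR.
  by rewrite in_itv /= h0.
apply: cvgM; first by apply: continuous_spherical_avg; rewrite ltW//= (le_trans hb).
by apply: cvgV; [rewrite gt_eqF// powR_gt0|exact: cp].
Qed.

Lemma M_eps_sub e' e x : 0 < e' -> e' <= e -> e <= 1 ->
  M_eps alpha e' f x - M_eps alpha e f x =
  \int[lebesgue_measure]_(h in `[e', e]) kernel x h.
Proof.
move=> e'0 e'e e1; rewrite !M_epsE.
have e0 : 0 < e by exact: lt_le_trans e'e.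
have := @Rintegral_itvB R (kernel x) (BLeft e') (BRight 1) e.
rewrite !bnd_simp => /(_ (kernel_integrable x e'0 (lexx _)) e'e e1).
rewrite Rintegral_itv_obnd_cbnd; first lra.
apply: integrableS (kernel_integrable x e'0 (lexx 1)) => //.
by move=> h; rewrite /= !in_itv /= => /andP[/ltW eh ->]; rewrite (le_trans e'e).
Qed.

(** On this range of radii h^(alpha+1) >= 2^-(j+1) r^(j+1), and the range has
    length at most 2^-(j+1): only the factor r^-(j+1) remains. *)
Lemma M_eps_combination_le (I : finType) (P : {pred I}) (c : I -> R)
    (x : I -> 'rV[R]_d) (b e' e : R) j :
  2 ^- j.+1 <= e' -> e' <= e -> e <= 2 ^- j ->
  (forall h xi, 2 ^- j.+1 <= h <= 2 ^- j -> `|xi| <= 1 ->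
     `|\sum_(i in P) c i * second_diff f (h *: xi) (x i)| <= b) ->
  `|\sum_(i in P) c i * (M_eps alpha e' f (x i) - M_eps alpha e f (x i))|
    <= b / r ^+ j.+1.
Proof.
move=> je' e'e ej Hb.
have j0 : 0 < (2 ^- j.+1 : R) by rewrite invr_gt0 exprn_gt0.
have e'0 : 0 < e' by exact: lt_le_trans je'.
have j1 : (2 ^- j : R) <= 1 by rewrite invf_le1 ?exprn_gt0// exprn_ege1// ler1n.
have e1 : e <= 1 by exact: le_trans ej j1.
have b0 : 0 <= b.
  apply: le_trans (Hb (2 ^- j) 0 _ _); rewrite ?normr0// ?lexx ?andbT//.
  by rewrite lef_pV2 ?posrE ?exprn_gt0// ler_weXn2l// ler1n.
have r0 : 0 < r ^+ j.+1 by rewrite exprn_gt0// half_powR_gt0.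
under eq_bigr do rewrite M_eps_sub//.
have powE : (2 ^- j.+1 : R) `^ (alpha + 1) = 2 ^- j.+1 * r ^+ j.+1.
  rewrite powRD; last by rewrite (gt_eqF j0) implybT.
  rewrite powRr1 ?(ltW j0)// mulrC; congr (_ * _).
  by rewrite -exprVn -[X in X `^ _]powR_mulrn ?invr_ge0// powRAC powR_mulrn// powR_ge0.
pose b' := b / (2 ^- j.+1 * r ^+ j.+1).
have b'0 : 0 <= b' by rewrite divr_ge0// mulr_ge0// ltW.
have /le_trans : `|\sum_(i in P) c i * \int[lebesgue_measure]_(h in `[e', e]) kernel (x i) h|
    <= b' * fine (lebesgue_measure `[e', e]%classic).
  apply: Rintegral_combination_le => //.
  - by apply: compact_finite_measure; exact: segment_compact.
  - by move=> i; exact: kernel_integrable.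
  move=> h /=; rewrite in_itv /= => /andP[e'h he].
  have jh : 2 ^- j.+1 <= h by exact: le_trans e'h.
  have h0 : 0 < h by exact: lt_le_trans jh.
  under eq_bigr do rewrite /kernel mulrA.
  rewrite -mulr_suml normrM [X in _ * X]ger0_norm ?invr_ge0 ?powR_ge0//.
  rewrite ler_pM// ?invr_ge0 ?powR_ge0//.
    apply: (@spherical_avg_combination_le R d d0 f I P c (fun=> h) x b cf) => xi xi1.
    by apply: Hb => //; rewrite jh (le_trans he).
  rewrite lef_pV2 ?posrE ?powR_gt0// ?mulr_gt0// -powE.
  by apply: ge0_ler_powR; rewrite ?nnegrE ?(ltW j0) ?(ltW h0)// addr_ge0// ltW.
apply.
have le : fine (lebesgue_measure `[e', e]%classic) <= 2 ^- j.+1.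
  rewrite lebesgue_measure_itv /=; case: ifP => _ /=; last exact: ltW.
  have : (2 ^- j : R) = 2 * 2 ^- j.+1 by rewrite exprS invfM mulrA mulfV ?mul1r// pnatr_eq0.
  by move: ej je'; lra.
apply: (le_trans (ler_wpM2l b'0 le)).
by rewrite /b' invfM mulrA mulrAC mulfVK// gt_eqF.
Qed.

End truncated_operator.

(** * A maximal inequality for finite dyadic martingales *)

(** A filtration on a finite uniform probability space, given by labels: two
    points are equivalent at time k when their labels at time k agree, and
    [class_avg k] is the conditional expectation. *)
Section finite_martingale.
Context {R : realType} {G : finType} {I : eqType}.
Variable label : nat -> G -> I.
Hypothesis label_refine : forall k y y', label k.+1 y = label k.+1 y' -> label k y = label k y'.
Implicit Types (g F : G -> R) (y : G).

Definition class k y : {pred G} := [pred y' | label k y' == label k y].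

Definition class_avg k g y : R := (\sum_(y' in class k y) g y') / #|class k y|%:R.

Lemma class_refl k y : y \in class k y. Proof. by rewrite inE. Qed.

Lemma class_eq k y y' : y' \in class k y -> class k y' = class k y.
Proof. by rewrite /class inE => /eqP ->. Qed.

Lemma class_card_gt0 k y : 0 < #|class k y|%:R :> R.
Proof. by rewrite ltr0n; apply/card_gt0P; exists y; exact: class_refl. Qed.

Lemma class_avg_class k g y y' : y' \in class k y -> class_avg k g y' = class_avg k g y.
Proof. by move=> /class_eq; rewrite /class_avg => ->. Qed.

Lemma le_class_avg k g g' y : (forall y', y' \in class k y -> g y' <= g' y') ->
  class_avg k g y <= class_avg k g' y.
Proof.
move=> gg'; rewrite ler_wpM2r ?invr_ge0 ?ler0n//.
by apply: ler_sum => y' y'y; exact: gg'.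
Qed.

Lemma eq_class_avg k g g' y : (forall y', y' \in class k y -> g y' = g' y') ->
  class_avg k g y = class_avg k g' y.
Proof. by move=> gg'; congr (_ / _); exact: eq_bigr. Qed.

Lemma class_avg_cst k (c : R) y : class_avg k (fun=> c) y = c.
Proof.
by rewrite /class_avg sumr_const -[c *+ _]mulr_natr mulfK// gt_eqF// class_card_gt0.
Qed.

Lemma class_avgD k g g' y :
  class_avg k (fun y' => g y' + g' y') y = class_avg k g y + class_avg k g' y.
Proof. by rewrite /class_avg big_split mulrDl. Qed.

Lemma class_avgZ k (c : R) g y :
  class_avg k (fun y' => c * g y') y = c * class_avg k g y.
Proof. by rewrite /class_avg -mulr_sumr mulrA. Qed.

(** Exchange the sums: each point is counted once for each member of its class,
    and is weighted by the inverse of the size of the class. *)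
Lemma sum_class_avg k g (Q : {pred G}) :
  (forall y y', y' \in class k y -> (y' \in Q) = (y \in Q)) ->
  \sum_(y in Q) class_avg k g y = \sum_(y in Q) g y.
Proof.
move=> Qk.
rewrite [RHS](eq_bigr (fun y' => \sum_(y in class k y') g y' / #|class k y|%:R)).
  rewrite [RHS](exchange_big_dep (mem Q)) /=.
    apply: eq_bigr => y Qy; rewrite /class_avg mulr_suml; apply: eq_bigl => y'.
    rewrite ![_ \in class k _]inE eq_sym.
    apply/idP/andP => [e|[]//]; split=> //.
    by rewrite (Qk y)// inE eq_sym.
  by move=> y' y Qy'; move=> /Qk ->.
move=> y' _; rewrite (eq_bigr (fun=> g y' / #|class k y'|%:R)).
  by rewrite sumr_const -[RHS]mulr_natr mulfVK// gt_eqF// class_card_gt0.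
by move=> y /class_eq ->.
Qed.

Lemma class_avg_tower k g y : class_avg k (class_avg k.+1 g) y = class_avg k g y.
Proof.
congr (_ / _); apply: sum_class_avg => y1 y2.
by rewrite !inE => /eqP /label_refine ->.
Qed.

(** From exp(-t) >= 1 - t and (1 - t)(1 + t + 2 t^2) = 1 + t^2 (1 - 2 t) >= 1. *)
Lemma expR_le_quadratic (t : R) : `|t| <= 2^-1 -> expR t <= 1 + t + 2 * t ^+ 2.
Proof.
move=> t2; have /andP[ta tb] : - 2^-1 <= t <= 2^-1 by rewrite -ler_norml.
have := expR_ge1Dx (- t); rewrite expRN => e.
have t1 : 0 < 1 - t by lra.
have le1 : expR t <= (1 - t)^-1 by rewrite -[leLHS]invrK lef_pV2// posrE ?invr_gt0 ?expR_gt0.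
apply: le_trans le1 _; rewrite -div1r ler_pdivrMr//.
have : 0 <= t ^+ 2 * (1 - 2 * t) by rewrite mulr_ge0 ?sqr_ge0//; lra.
rewrite expr2; lra.
Qed.

Variables (F : G -> R) (c l : R) (T : nat).
Hypotheses (l0 : 0 <= l) (lc : l * c <= 2^-1).
Let X k := class_avg k F.
Hypothesis Xc : forall k y, (k < T)%N -> `|X k.+1 y - X k y| <= c.

(** Conditioning on the first step replaces the level a by a - Y, where Y is the
    increment.  The induction hypothesis then leaves the average of exp(l Y),
    which is at most exp(2 (l c)^2) as Y has mean zero and |l Y| <= 1/2. *)
Lemma class_avg_maximal m k (a : R) y : (k + m = T)%N ->
  class_avg k (fun y' => (has (fun n => a <= X (k + n)%N y' - X k y') (iota 0 m.+1))%:R) y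
    <= expR (- l * a + 2 * (l * c) ^+ 2 * m%:R).
Proof.
(* For a <= 0 the bound is at least 1, so that both cases may take a > 0. *)
elim: m k a y => [|m IH] k a y kT; set ind := (fun _ => _);
    (have [a0|a0] := lerP a 0;
    [rewrite (le_trans (y := class_avg k (fun=> 1) y))//;
      [by apply: le_class_avg => y' _; rewrite /ind; case: has|];
     rewrite class_avg_cst -expR0 ler_expR; apply: addr_ge0;
     [by rewrite mulNr oppr_ge0 mulr_ge0_le0|by rewrite mulr_ge0// mulr_ge0// sqr_ge0]|]).
  have -> : class_avg k ind y = class_avg k (fun=> 0) y.
    by apply: eq_class_avg => y' _; rewrite /ind /= addn0 subrr leNgt a0.
  by rewrite class_avg_cst expR_ge0.
pose Y y' := X k.+1 y' - X k y.
pose E := expR (- l * a + 2 * (l * c) ^+ 2 * m%:R).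
have kT1 : (k < T)%N by rewrite -kT addnS ltnS leq_addr.
have step y' : y' \in class k y -> class_avg k.+1 ind y' <= E * expR (l * Y y').
  move=> y'k; have := IH k.+1 (a - Y y') y'; rewrite addSn -addnS => /(_ kT).
  rewrite /E -expRD (_ : - l * a + _ + _ = - l * (a - Y y') + 2 * (l * c) ^+ 2 * m%:R); last ring.
  apply: le_trans; apply: le_class_avg => y'' y''k.
  have y''k' : y'' \in class k y.
    by move: y'k y''k; rewrite !inE => /eqP <- /eqP /label_refine ->.
  rewrite /ind ler_nat; case: (boolP (has _ (iota 0 m.+2))) => // /hasP[n].
  rewrite mem_iota add0n => /andP[_ nm] an.
  case: n => [|n] in nm an *; first by move: an; rewrite addn0 subrr leNgt a0.
  rewrite lt0b; apply/hasP; exists n; first by rewrite mem_iota.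
  rewrite addSn -addnS /Y /X -(class_avg_class F y''k).
  by move: an; rewrite /X (class_avg_class F y''k'); lra.
rewrite -class_avg_tower (le_trans (le_class_avg step))// class_avgZ.
have Yc y' : y' \in class k y -> `|Y y'| <= c.
  by move=> y'k; rewrite /Y /X -(class_avg_class F y'k) Xc.
have quad y' : y' \in class k y ->
    expR (l * Y y') <= (1 + 2 * (l * c) ^+ 2) + l * Y y'.
  move=> y'k; have Yc' := Yc _ y'k.
  have lY : `|l * Y y'| <= l * c by rewrite normrM ger0_norm// ler_wpM2l.
  have := expR_le_quadratic (le_trans lY lc).
  have : (l * Y y') ^+ 2 <= (l * c) ^+ 2.
    by rewrite -real_normK ?num_real// lerXn2r ?nnegrE// (le_trans _ lY).
  lra.
have -> : expR (- l * a + 2 * (l * c) ^+ 2 * m.+1%:R) = E * expR (2 * (l * c) ^+ 2).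
  by rewrite /E -expRD -natr1; congr expR; ring.
rewrite ler_pM2l ?expR_gt0//; apply: (le_trans (le_class_avg quad)).
rewrite class_avgD class_avg_cst class_avgZ.
have -> : class_avg k Y y = 0.
  rewrite /Y class_avgD class_avg_cst (_ : class_avg k _ y = X k y) ?subrr//.
  exact: class_avg_tower.
by rewrite mulr0 addr0 expR_ge1Dx.
Qed.

End finite_martingale.

Section maximal_inequality.
Context {R : realType} {G : finType} {I : eqType}.
Variable label : nat -> G -> I.
Hypothesis label_refine : forall k y y', label k.+1 y = label k.+1 y' -> label k y = label k y'.
Variables (c l : R) (T : nat).
Hypotheses (l0 : 0 <= l) (lc : l * c <= 2^-1).
Implicit Type F : G -> R.

Lemma class_avgN k F y : class_avg label k (fun y' => - F y') y = - class_avg label k F y.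
Proof. by rewrite /class_avg sumrN mulNr. Qed.

Let count_le F a :
  (forall k y, (k < T)%N -> `|class_avg label k.+1 F y - class_avg label k F y| <= c) ->
  #|[pred y | has (fun n => a <= class_avg label n F y - class_avg label 0 F y) (iota 0 T.+1)]|%:R
  <= #|G|%:R * expR (- l * a + 2 * (l * c) ^+ 2 * T%:R).
Proof.
move=> Fc; set P := [pred _ | _]; rewrite -sum1_card natr_sum big_mkcond /=.
pose ind y := (has (fun n => a <= class_avg label (0 + n) F y - class_avg label 0 F y) (iota 0 T.+1))%:R : R.
rewrite (eq_bigr ind); last first.
  by move=> y _; rewrite -[RHS]/((y \in P)%:R : R); case: ifP.
have -> : \sum_y ind y = \sum_y class_avg label 0 ind y.
  transitivity (\sum_(y in predT) ind y); first exact: eq_bigl.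
  by rewrite -(@sum_class_avg R G I label 0 ind predT (fun _ _ _ => erefl)); exact: eq_bigl.
rewrite mulr_natl -sumr_const [leRHS](eq_bigl xpredT)//; apply: ler_sum => y _.
exact: (class_avg_maximal label_refine l0 lc Fc a y (add0n T)).
Qed.

(** Two-sided version, obtained from F and - F. *)
Lemma maximal_inequality F a :
  (forall k y, (k < T)%N -> `|class_avg label k.+1 F y - class_avg label k F y| <= c) ->
  #|[pred y | has (fun n => a <= `|class_avg label n F y - class_avg label 0 F y|) (iota 0 T.+1)]|%:R
  <= 2 * #|G|%:R * expR (- l * a + 2 * (l * c) ^+ 2 * T%:R).
Proof.
move=> Fc.
have c1 := count_le a Fc.
have c2 := @count_le (fun y => - F y) a.
rewrite -mulrA mulr2n mulrDl mul1r; apply: le_trans (lerD c1 (c2 _)); last first.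
  by move=> k y kT; rewrite !class_avgN -opprD normrN; exact: Fc.
rewrite -natrD ler_nat -cardUI; apply: leq_trans (leq_addr _ _).
apply: subset_leq_card; apply/fintype.subsetP => y; rewrite !inE => /hasP[n nT].
rewrite ler_normr => /orP[an|an]; apply/orP; [left|right]; apply/hasP; exists n => //.
by rewrite !class_avgN -opprD.
Qed.

End maximal_inequality.

(** * Translations of a lattice cube *)

Section lattice_shift.
Context {R : realType}.
Variables (d L : nat).
Hypothesis L0 : (0 < L)%N.
Implicit Types (s : {ffun 'I_d -> 'I_L}) (a z : 'I_d -> int).

Lemma sum_ltn_ord (A : nat) : (\sum_(t < L) (t < A) <= A)%N.
Proof.
suff -> : (\sum_(t < L) (t < A))%N = minn A L by exact: geq_minl.
elim: L => [|n IH]; first by rewrite big_ord0 minn0.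
by rewrite big_ord_recr /= IH; lia.
Qed.

Lemma sum_wrap_le (a : int) (A : nat) : (`|a| <= A)%N ->
  (\sum_(t < L) (~~ (0 <= t%:Z + a < L%:Z)%R) <= A)%N.
Proof.
move=> aA; have [a0|a0] := lerP 0 a.
  rewrite (reindex_inj rev_ord_inj) /=; apply: leq_trans (sum_ltn_ord A).
  by apply: leq_sum => t _; have := ltn_ord t; lia.
apply: leq_trans (sum_ltn_ord A).
by apply: leq_sum => t _; have := ltn_ord t; lia.
Qed.

Lemma wrap_ltn (x : int) : (`|(x %% L%:Z)%Z| < L)%N.
Proof. by have := ltz_pmod x (d := L%:Z); have := modz_ge0 x (d := L%:Z); lia. Qed.

(** Translation by a modulo L, a bijection of the cube that agrees with the
    ordinary translation except near the boundary. *)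
Definition cyclic_shift a s : {ffun 'I_d -> 'I_L} :=
  [ffun i => Ordinal (wrap_ltn ((s i)%:Z + a i))].

Lemma cyclic_shift_inj a : injective (cyclic_shift a).
Proof.
move=> s s' /ffunP e; apply/ffunP => i; apply/val_inj => /=.
have := congr1 val (e i); rewrite !ffunE /= => e'.
have : ((s i)%:Z + a i = (s' i)%:Z + a i %[mod L%:Z])%Z.
  by have := modz_ge0 ((s i)%:Z + a i) (d := L%:Z);
     have := modz_ge0 ((s' i)%:Z + a i) (d := L%:Z); lia.
move/eqP; rewrite eqz_modDr !modz_small ?ltz_nat ?ltn_ord//.
by move=> /eqP [].
Qed.

(** The condition involves only the coordinate i, so that the sum over the cube
    factors. *)
Lemma sum_wrap_coord_le a (A : nat) i : (`|a i| <= A)%N ->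
  \sum_(s : {ffun 'I_d -> 'I_L}) (~~ (0 <= (s i)%:Z + a i < L%:Z))%:R <= A%:R * L%:R ^+ d / L%:R :> R.
Proof.
move=> aA.
pose F (i' : 'I_d) (t : 'I_L) : R :=
  if i' == i then (~~ (0 <= t%:Z + a i < L%:Z))%:R else 1.
rewrite (eq_bigr (fun s : {ffun 'I_d -> 'I_L} => \prod_i' F i' (s i'))); last first.
  move=> s _; rewrite (bigD1 i)//= {1}/F eqxx big1 ?mulr1// => i' /negPf ii'.
  by rewrite /F ii'.
rewrite -bigA_distr_bigA /= (bigD1 i)//=.
have -> : \prod_(i' < d | i' != i) \sum_(j < L) F i' j = L%:R ^+ d.-1.
  rewrite (eq_bigr (fun=> L%:R)); last first.
    move=> i' /negPf ii'; rewrite (eq_bigr (fun=> 1)); last by move=> j _; rewrite /F ii'.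
    by rewrite sumr_const card_ord.
  by rewrite prodr_const cardC1 card_ord.
have L0' : (L%:R : R) != 0 by rewrite pnatr_eq0 -lt0n.
have -> : A%:R * L%:R ^+ d / L%:R = A%:R * L%:R ^+ d.-1 :> R.
  by rewrite -[in LHS](ltn_predK (ltn_ord i)) exprSr mulrA mulfK.
rewrite ler_wpM2r ?exprn_ge0 ?ler0n//.
have -> : \sum_(j < L) F i j = (\sum_(t < L) (~~ (0 <= t%:Z + a i < L%:Z)%R))%N%:R.
  by rewrite natr_sum; apply: eq_bigr => t _; rewrite /F eqxx.
by rewrite ler_nat; exact: sum_wrap_le.
Qed.

(** The sum of p over the cube is unchanged by the cyclic shift, so only the points
    whose translate leaves the cube contribute. *)
Lemma lattice_shift_sum_le (p : ('I_d -> int) -> R) (z a : 'I_d -> int) (A : nat) (D : R) :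
  (forall i, (`|a i| <= A)%N) ->
  (forall s, `|p (fun i => z i + (s i)%:Z)| <= D) ->
  (forall s, `|p (fun i => z i + (s i)%:Z + a i)| <= D) ->
  `|\sum_(s : {ffun 'I_d -> 'I_L}) (p (fun i => z i + (s i)%:Z + a i) - p (fun i => z i + (s i)%:Z))|
    <= 2 * D * (d * A)%:R * L%:R ^+ d / L%:R.
Proof.
move=> aA pD paD.
have D0 : 0 <= D by apply: le_trans (pD [ffun=> Ordinal L0]).
rewrite sumrB [X in _ - X](reindex_inj (@cyclic_shift_inj a)) -sumrB.
apply: (le_trans (ler_norm_sum _ _ _)).
apply: (@le_trans _ _ (\sum_(s : {ffun 'I_d -> 'I_L}) \sum_i 2 * D * (~~ (0 <= (s i)%:Z + a i < L%:Z))%:R)).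
  apply: ler_sum => s _.
  have [/existsP[i wi]|/existsPn nw] := boolP [exists i, ~~ (0 <= (s i)%:Z + a i < L%:Z)].
    rewrite (bigD1 i)//= wi mulr1 ler_wpDr//.
      by apply: sumr_ge0 => j _; rewrite !mulr_ge0.
    apply: (le_trans (ler_normB _ _)).
    by rewrite mulr2n mulrDl mul1r; apply: lerD; [exact: paD|exact: pD].
  have -> : (fun i => z i + (cyclic_shift a s i)%:Z) = (fun i => z i + (s i)%:Z + a i).
    apply/funext => i; rewrite -addrA; congr (_ + _); rewrite ffunE /=.
    have := nw i; rewrite negbK => si.
    by rewrite (modz_small si) gez0_abs//; case/andP: si.
  rewrite subrr normr0; apply: sumr_ge0 => j _; by rewrite !mulr_ge0.
rewrite exchange_big /=.
apply: (@le_trans _ _ (\sum_(i < d) 2 * D * (A%:R * L%:R ^+ d / L%:R))).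
  apply: ler_sum => i _; rewrite -mulr_sumr ler_wpM2l ?mulr_ge0//.
  exact: sum_wrap_coord_le.
by rewrite sumr_const card_ord -mulr_natr natrM le_eqVlt; apply/orP; left; apply/eqP; ring.
Qed.

End lattice_shift.

Section dyadic_classes.
Context {R : realType}.
Variables (d M T : nat).
Implicit Types y : {ffun 'I_d -> 'I_(M * 2 ^ T)}.

(** The label at time k of a point of the lattice of mesh 2^-T is its dyadic cube
    of side 2^-k. *)
Definition dyadic_index k y : {ffun 'I_d -> nat} :=
  [ffun i => (y i %/ 2 ^ (T - k))%N].

Lemma dyadic_index_refine k y y' :
  dyadic_index k.+1 y = dyadic_index k.+1 y' -> dyadic_index k y = dyadic_index k y'.
Proof.
move=> /ffunP e; apply/ffunP => i; have := e i; rewrite !ffunE => ei.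
have [Tk|kT] := leqP T k.
  have -> : (T - k = T - k.+1)%N by lia.
  exact: ei.
have -> : (T - k = (T - k.+1).+1)%N by lia.
by rewrite expnSr !divnMA ei.
Qed.

(** A cube of side 2^-k contains the lattice points L q + s, with L = 2^(T-k) and
    0 <= s < L in each coordinate. *)
Lemma sum_dyadic_class (g : ('I_d -> int) -> R) k y : (k <= T)%N ->
  \sum_(y' in class dyadic_index k y) g (fun i => (y' i)%:Z) =
  \sum_(s : {ffun 'I_d -> 'I_(2 ^ (T - k))})
     g (fun i => (2 ^ (T - k) * dyadic_index k y i)%:Z + (s i)%:Z).
Proof.
move=> kT; set L := (2 ^ (T - k))%N.
have L0 : (0 < L)%N by rewrite expn_gt0.
have q_lt i (s : 'I_L) : (L * dyadic_index k y i + s < M * 2 ^ T)%N.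
  have e : (M * 2 ^ T = L * (M * 2 ^ k))%N by rewrite mulnCA -expnD subnK.
  have q : (dyadic_index k y i < M * 2 ^ k)%N.
    by rewrite ffunE ltn_divLR// (leq_trans (ltn_ord (y i)))// e mulnC.
  apply: (@leq_trans (L * (dyadic_index k y i).+1)).
    by rewrite mulnS addnC ltn_add2r.
  by rewrite e leq_mul2l q orbT.
pose h (s : {ffun 'I_d -> 'I_L}) : {ffun 'I_d -> 'I_(M * 2 ^ T)} :=
  [ffun i => Ordinal (q_lt i (s i))].
pose h' y : {ffun 'I_d -> 'I_L} := [ffun i => Ordinal (ltn_pmod (y i) L0)].
rewrite (reindex_onto h h'); last first.
  move=> y' y'y; apply/ffunP => i; rewrite [h _ _]ffunE; apply/val_inj => /=.
  have -> : dyadic_index k y i = (y' i %/ L)%N.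
    by move: y'y; rewrite inE => /eqP/ffunP/(_ i) <-; rewrite ffunE.
  by rewrite [h' _ _]ffunE /= mulnC; exact/esym/divn_eq.
apply: eq_big => s.
  apply/andP; split; last first.
    apply/eqP/ffunP => i; apply/val_inj; rewrite [h' _ _]ffunE /= [h _ _]ffunE /=.
    by rewrite mulnC modnMDl modn_small.
  rewrite inE; apply/eqP/ffunP => i; rewrite [LHS]ffunE [h s i]ffunE /=.
  by rewrite mulnC divnMDl// divn_small// addn0.
by move=> _; congr g; apply/funext => i; rewrite [h s i]ffunE /= PoszD.
Qed.

Lemma card_dyadic_class k y : (k <= T)%N ->
  #|class dyadic_index k y|%:R = (2 ^ (T - k))%:R ^+ d :> R.
Proof.
move=> kT; rewrite -sum1_card natr_sum.
rewrite (@sum_dyadic_class (fun=> 1))// sumr_const card_ffun !card_ord.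
by rewrite -natrX.
Qed.

End dyadic_classes.

(** * Regularity and cancellation of the dyadic truncations *)

Section dyadic_truncations.
Context {R : realType}.
Variables (d : nat) (alpha B : R) (f : 'rV[R]_d -> R).
Let r : R := 2^-1 `^ alpha.
Hypotheses (d0 : (0 < d)%N) (alpha_gt0 : 0 < alpha) (alpha_le1 : alpha <= 1).
Hypotheses (cf : continuous f) (B0 : 0 <= B) (fB : dyadic_zygmund f B r).
Implicit Types (x : 'rV[R]_d).

Let r12 : 2^-1 <= r. Proof. exact: half_powR_ge. Qed.
Let r1 : r < 1. Proof. exact: half_powR_lt1. Qed.
Let r0 : 0 < r. Proof. exact: half_powR_gt0. Qed.
Let r01 : 0 <= r < 1. Proof. by rewrite ltW//= r1. Qed.

Definition dyadic_M k x : R := M_eps alpha (2 ^- k) f x.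

(** A bound for all the errors of this section; (1 - r)^-2 is the sum of the
    series (m+1) r^m over the scales. *)
Definition dyadic_const : R := 16 * d.+1%:R * B * (1 - r) ^- 2.

Let invV : 1 <= (1 - r) ^- 2 :> R.
Proof. by rewrite invf_ge1 ?exprn_gt0 ?subr_gt0// exprn_ile1 ?subr_ge0 ?(ltW r1)// gerBl ltW. Qed.

Let BV0 : 0 <= B * (1 - r) ^- 2.
Proof. by rewrite mulr_ge0// (le_trans _ invV). Qed.

Lemma le_dyadic_const (c : R) : c <= 16 * d.+1%:R -> c * (B * (1 - r) ^- 2) <= dyadic_const.
Proof. by move=> cd; rewrite /dyadic_const -[leRHS]mulrA ler_wpM2r. Qed.

Lemma dyadic_const_ge0 : 0 <= dyadic_const.
Proof. by apply: le_trans (@le_dyadic_const 0 _); rewrite ?mul0r// mulr_ge0. Qed.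

Lemma dyadic_ratio_le j m : r ^+ (j + m) / r ^+ j.+1 <= 2 * r ^+ m.
Proof.
rewrite exprD exprS ler_pdivrMr ?mulr_gt0 ?exprn_gt0//.
have h : 0 <= r ^+ m * r ^+ j by rewrite mulr_ge0// exprn_ge0// ltW.
have := ler_wpM2r h r12; nra.
Qed.

Lemma dyadic_M0 x : dyadic_M 0 x = 0.
Proof. by rewrite /dyadic_M M_epsE expr0 invr1 set_itv1 Rintegral_set1. Qed.

Lemma dyadic_M_telescope k m x : dyadic_M (k + m) x =
  dyadic_M k x + \sum_(i < m) (dyadic_M (k + i).+1 x - dyadic_M (k + i) x).
Proof.
elim: m => [|m IH]; first by rewrite big_ord0 addr0 addn0.
rewrite big_ord_recr /= addrA -IH addnS; ring.
Qed.

Lemma le_expVn2 j k : (j <= k)%N -> (2 ^- k : R) <= 2 ^- j.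
Proof. by move=> jk; rewrite lef_pV2 ?posrE ?exprn_gt0// ler_weXn2l// ler1n. Qed.

Let scaled_le (c h : R) xi j : c <= 4 -> `|xi| <= 1 -> 0 <= h <= c * 2 ^- j ->
  `|h *: xi : 'rV[R]_d| <= 4 * 2 ^- j.
Proof.
move=> c4 xi1 /andP[h0 hc]; rewrite normrZ ger0_norm//.
have : 0 < (2 ^- j : R) by rewrite invr_gt0 exprn_gt0.
have := normr_ge0 xi; nra.
Qed.

(** It bounds one increment of the dyadic truncations, and also the passage from
    a dyadic lower limit to any other. *)
Lemma M_eps_osc_le j e' e x : 2 ^- j.+1 <= e' -> e' <= e -> e <= 2 ^- j ->
  `|M_eps alpha e' f x - M_eps alpha e f x| <= dyadic_const.
Proof.
move=> je' e'e ej.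
have H : `|M_eps alpha e' f x - M_eps alpha e f x| <= B * r ^+ j / r ^+ j.+1.
  have := @M_eps_combination_le R d alpha B f d0 alpha_gt0 alpha_le1 cf B0 fB
    unit predT (fun=> 1) (fun=> x) (B * r ^+ j) e' e j je' e'e ej.
  rewrite (eq_bigl xpredT)// (big_pred1 tt)/=; last by case.
  rewrite mul1r; apply=> h xi /andP[h1 h2] xi1.
  rewrite (eq_bigl xpredT)// (big_pred1 tt)/=; last by case.
  rewrite mul1r; apply: fB; apply: (@scaled_le 1) => //; first by rewrite ler1n.
  by rewrite mul1r h2 andbT; apply: le_trans h1; rewrite invr_ge0 exprn_ge0.
apply: (le_trans H).
have := dyadic_ratio_le j 0; rewrite addn0 expr0 mulr1 => rr.
rewrite -mulrA; apply: (@le_trans _ _ (2 * (B * (1 - r) ^- 2))).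
  have := ler_wpM2l B0 rr; have := ler_wpM2l B0 invV; lra.
by apply: le_dyadic_const; rewrite -natr1; have := ler0n R d; lra.
Qed.

(** Regularity: at the scale 2^-k of the distance, the piece j < k contributes
    (k-j+1) r^(k-j). *)
Lemma dyadic_M_dist_le k x y : `|y - x| <= 2 ^- k ->
  `|dyadic_M k y - dyadic_M k x| <= dyadic_const.
Proof.
move=> yx.
have e : dyadic_M k y - dyadic_M k x = \sum_(i < k)
   ((dyadic_M i.+1 y - dyadic_M i y) - (dyadic_M i.+1 x - dyadic_M i x)).
  have sumE z := dyadic_M_telescope 0 k z.
  by rewrite (sumE y) (sumE x) !dyadic_M0 !add0r -sumrB.
rewrite e; apply: (le_trans (ler_norm_sum _ _ _)).
apply: (@le_trans _ _ (\sum_(i < k) 8 * B * ((k - i).+1%:R * r ^+ (k - i)))).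
  apply: ler_sum => i _.
  have ik := ltn_ord i.
  set Q := 4 * B * (k - i).+1%:R.
  have Q0 : 0 <= Q by rewrite !mulr_ge0.
  have H : `|(dyadic_M i.+1 y - dyadic_M i y) - (dyadic_M i.+1 x - dyadic_M i x)|
      <= Q * r ^+ (i + (k - i)) / r ^+ i.+1.
    have := @M_eps_combination_le R d alpha B f d0 alpha_gt0 alpha_le1 cf B0 fB
      bool predT (fun b => if b then 1 else -1) (fun b => if b then y else x)
      (Q * r ^+ (i + (k - i))) (2 ^- i.+1) (2 ^- i) i
      (lexx _) (le_expVn2 (leqnSn i)) (lexx _).
    rewrite (eq_bigl xpredT)// big_bool /= mul1r mulN1r; apply=> h xi /andP[h1 h2] xi1.
    rewrite (eq_bigl xpredT)// big_bool /= mul1r mulN1r.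
    have {1}-> : y = x + (y - x) by rewrite addrC subrK.
    apply: (second_diff_shift_le B0 r12 fB).
      apply: (@scaled_le 1) => //; first by rewrite ler1n.
      by rewrite mul1r h2 andbT; apply: le_trans h1; rewrite invr_ge0 exprn_ge0.
    rewrite subnKC ?(ltnW ik)//; apply: (le_trans yx).
    have : 0 < (2 ^- k : R) by rewrite invr_gt0 exprn_gt0.
    lra.
  apply: (le_trans H).
  have rr := dyadic_ratio_le i (k - i).
  have := ler_wpM2l Q0 rr; rewrite mulrA /Q; lra.
rewrite -mulr_sumr.
have B8 : 0 <= 8 * B by rewrite mulr_ge0.
apply: (le_trans (ler_wpM2l B8 (arith_geom_rev_sum_le k r01))).
by rewrite -mulrA; apply: le_dyadic_const; rewrite -natr1; have := ler0n R d; lra.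
Qed.

Section dyadic_grid.
Variables (s0 : R) (M T : nat).
Let G : finType := {ffun 'I_d -> 'I_(M * 2 ^ T)}.
Implicit Types (y : {ffun 'I_d -> 'I_(M * 2 ^ T)}).

Definition dyadic_point y : 'rV[R]_d := grid_point s0 (2 ^- T) y.

Let lattice_point (z : 'I_d -> int) : 'rV[R]_d := \row_i (s0 + 2 ^- T * (z i)%:~R).

(** Cancellation.  After rounding v to a lattice vector V = 2^-T a, write
    D_V f(x) = p(x+V) - p(x) with p(x) = f(x) - f(x-V) - const: the sum over a
    cube is a translation defect of p.  With the constant taken at the corner of
    the cube, p is a mixed difference, hence small on a neighbourhood of the
    cube. *)
Lemma sum_class_second_diff_le k i m y v : T = (k + i + m)%N ->
  `|v| <= 2 ^- (k + i) ->
  `|\sum_(y' in class (@dyadic_index d M T) k y) second_diff f v (dyadic_point y')| <=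
  (2 ^ (T - k))%:R ^+ d * (2 * B * m.+1%:R * r ^+ T +
     8 * d%:R * B * (i.+1%:R * r ^+ (k + i) * 2 ^- i)).
Proof.
move=> hT vj.
have kT : (k <= T)%N by rewrite hT -addnA leq_addr.
pose delta : R := 2 ^- T.
have delta0 : 0 < delta by rewrite invr_gt0 exprn_gt0.
have deltaj : delta * 2 ^+ m = 2 ^- (k + i).
  by rewrite /delta hT [in 2 ^+ (k + i + m)]exprD invfM mulfVK// expf_neq0// pnatr_eq0.
have m1 : 1 <= 2 ^+ m :> R by rewrite exprn_ege1// ler1n.
pose a i' : int := Num.floor (v ord0 i' / delta).
have av i' : (a i')%:~R * delta <= v ord0 i' < ((a i')%:~R + 1) * delta.
  have := floor_itv (v ord0 i' / delta); rewrite -/(a i') intrD.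
  by rewrite ler_pdivlMr// ltr_pdivrMr.
pose V : 'rV[R]_d := \row_i' (delta * (a i')%:~R).
have vV : `|v - V| <= delta.
  apply: rV_norm_le => [|i']; first exact: ltW.
  by rewrite !mxE; have /andP[] := av i'; rewrite ler_norml; nra.
have Vj : `|V| <= 2 * 2 ^- (k + i).
  have := ler_normB v (v - V); rewrite subKr -deltaj.
  move: vj vV; rewrite -deltaj; nra.
have rounding : `|\sum_(y' in class (@dyadic_index d M T) k y)
    (second_diff f v (dyadic_point y') - second_diff f V (dyadic_point y'))| <=
    (2 ^ (T - k))%:R ^+ d * (2 * B * m.+1%:R * r ^+ T).
  rewrite -(card_dyadic_class y kT) mulr_natl -sumr_const.
  apply: (le_trans (ler_norm_sum _ _ _)); apply: ler_sum => y' _.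
  rewrite hT; apply: (second_diff_step_le B0 r12 fB).
    apply: (le_trans (ler_normD _ _)); have := normr_ge0 v; lra.
  by rewrite -hT; apply: (le_trans vV); rewrite /delta -/delta; lra.
have boundary : `|\sum_(y' in class (@dyadic_index d M T) k y) second_diff f V (dyadic_point y')| <=
    (2 ^ (T - k))%:R ^+ d * (8 * d%:R * B * (i.+1%:R * r ^+ (k + i) * 2 ^- i)).
  pose z (i' : 'I_d) : int := (2 ^ (T - k) * dyadic_index k y i')%:Z.
  pose x0 := lattice_point z.
  pose p w := f (lattice_point w) - f (lattice_point w - V) - (f x0 - f (x0 - V)).
  pose D := 2 * B * i.+1%:R * r ^+ (k + i).
  have shiftE w : lattice_point (fun i' => w i' + a i') = lattice_point w + V.
    by apply/rowP => i'; rewrite !mxE intrD /delta mulrDr addrA.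
  have pD w : `|lattice_point w - x0| <= 4 * 2 ^- k -> `|p w| <= D.
    move=> wx0; have VN : `|- V| <= 4 * 2 ^- (k + i).
      by rewrite normrN (le_trans Vj)// ler_wpM2r ?invr_ge0 ?exprn_ge0//; lra.
    have := mixed_diff_le B0 r12 fB x0 wx0 VN; congr (_ <= _).
    rewrite -normrN /mixed_diff /p.
    have -> : x0 + (lattice_point w - x0) = lattice_point w by rewrite addrC subrK.
    by congr `|_|; ring.
  have L0 : (0 < 2 ^ (T - k))%N by rewrite expn_gt0.
  have deltaL : delta * (2 ^ (T - k))%:R = 2 ^- k.
    have E : 2 ^+ T = 2 ^+ k * 2 ^+ (T - k) :> R by rewrite -exprD subnKC.
    by rewrite /delta E invfM natrX mulfVK// expf_neq0// pnatr_eq0.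
  have sx0 (s : {ffun 'I_d -> 'I_(2 ^ (T - k))}) :
      `|lattice_point (fun i' => z i' + (s i')%:Z) - x0| <= 2 ^- k.
    apply: rV_norm_le => [|i']; first by rewrite invr_ge0 exprn_ge0.
    rewrite !mxE intrD -deltaL.
    have -> : s0 + 2 ^- T * ((z i')%:~R + (s i')%:~R) - (s0 + 2 ^- T * (z i')%:~R) =
       delta * ((s i')%:Z)%:~R.
      by rewrite -/delta; ring.
    rewrite -pmulrn ger0_norm ?mulr_ge0 ?(ltW delta0)// ler_wpM2l ?(ltW delta0)//.
    by rewrite ler_nat ltnW.
  have aA i' : (`|a i'| <= 2 * 2 ^ m)%N.
    rewrite -(ler_nat R) natrM natrX natr_absz intr_norm.
    rewrite -(ler_pM2r delta0) -[X in _ * X <= _](ger0_norm (ltW delta0)) -normrM.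
    have := coord_le_rV_norm V i'; rewrite mxE mulrC => /le_trans; apply.
    by move: Vj; rewrite -deltaj; lra.
  have -> : \sum_(y' in class (@dyadic_index d M T) k y) second_diff f V (dyadic_point y') =
     \sum_(s : {ffun 'I_d -> 'I_(2 ^ (T - k))}) (p (fun i' => z i' + (s i')%:Z + a i') -
        p (fun i' => z i' + (s i')%:Z)).
    rewrite -(@sum_dyadic_class R d M T (fun w => p (fun i' => w i' + a i') - p w))//.
    apply: eq_bigr => y' _.
    rewrite /p shiftE addrK /second_diff.
    have -> : lattice_point (fun i' => (y' i')%:Z) = dyadic_point y'.
      by apply/rowP => i'; rewrite !mxE -pmulrn.
    by ring.
  have := @lattice_shift_sum_le R d (2 ^ (T - k)) L0 p z a (2 * 2 ^ m) D aA.
  have e4 : 0 < (2 ^- k : R) by rewrite invr_gt0 exprn_gt0.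
  move=> H; apply: (le_trans (H _ _)) => {H}.
  - by move=> s; apply: pD; apply: (le_trans (sx0 s)); lra.
  - move=> s; apply: pD; rewrite shiftE addrAC.
    apply: (le_trans (ler_normD _ _)).
    have ki : (2 ^- (k + i) : R) <= 2 ^- k by apply: le_expVn2; exact: leq_addr.
    have := sx0 s; move: Vj; lra.
  have -> : (T - k = i + m)%N by rewrite hT -addnA addKn.
  rewrite /D le_eqVlt; apply/orP; left; apply/eqP.
  set LL := (2 ^ (i + m))%:R ^+ d.
  rewrite !natrM !natrX [2 ^+ (i + m)]exprD.
  have ui : 2 ^+ i != 0 :> R by rewrite expf_neq0// pnatr_eq0.
  have um : 2 ^+ m != 0 :> R by rewrite expf_neq0// pnatr_eq0.
  move: (2 ^+ i) (2 ^+ m) (r ^+ (k + i)) ui um => u w rr u0 w0.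
  by field; rewrite u0 w0.
have -> : \sum_(y' in class (@dyadic_index d M T) k y) second_diff f v (dyadic_point y') =
  \sum_(y' in class (@dyadic_index d M T) k y)
    (second_diff f v (dyadic_point y') - second_diff f V (dyadic_point y')) +
  \sum_(y' in class (@dyadic_index d M T) k y) second_diff f V (dyadic_point y').
  by rewrite -big_split /=; apply: eq_bigr => y' _; rewrite subrK.
by rewrite mulrDr (le_trans (ler_normD _ _))// lerD.
Qed.

End dyadic_grid.

End dyadic_truncations.

Section grid_martingale.
Context {R : realType}.
Variables (d : nat) (alpha B : R) (f : 'rV[R]_d -> R).
Let r : R := 2^-1 `^ alpha.
Hypotheses (d0 : (0 < d)%N) (alpha_gt0 : 0 < alpha) (alpha_le1 : alpha <= 1).
Hypotheses (cf : continuous f) (B0 : 0 <= B) (fB : dyadic_zygmund f B r).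
Variables (s0 : R) (M T : nat).
Let G : finType := {ffun 'I_d -> 'I_(M * 2 ^ T)}.
Let U := dyadic_M alpha f.
Let K := dyadic_const d alpha B.
Let pt : G -> 'rV[R]_d := @dyadic_point R d s0 M T.
Let label := @dyadic_index d M T.
Implicit Types y : G.

Let r12 : 2^-1 <= r. Proof. exact: half_powR_ge. Qed.
Let r1 : r < 1. Proof. exact: half_powR_lt1. Qed.
Let r0 : 0 < r. Proof. exact: half_powR_gt0. Qed.
Let r01 : 0 <= r < 1. Proof. by rewrite ltW//= r1. Qed.

(** A martingale in k, as the conditional expectations of one function. *)
Definition grid_martingale k y : R := class_avg label k (fun y' => U T (pt y')) y.

Let term_le k i m y : T = (k + m)%N -> (i < m)%N ->
  `|class_avg label k (fun y' => U (k + i).+1 (pt y') - U (k + i) (pt y')) y| <=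
  4 * B * ((m - i).+1%:R * r ^+ (m - i)) + 16 * d%:R * B * (i.+1%:R * r ^+ i).
Proof.
move=> hT im.
have hT' : T = (k + i + (m - i))%N by rewrite -addnA subnKC// ltnW.
have kT : (k <= T)%N by rewrite hT leq_addr.
set b := 2 * B * (m - i).+1%:R * r ^+ T +
     8 * d%:R * B * (i.+1%:R * r ^+ (k + i) * 2 ^- i).
set L := (2 ^ (T - k))%:R ^+ d : R.
have H : `|\sum_(y' in class label k y) (U (k + i).+1 (pt y') - U (k + i) (pt y'))| <=
    L * b / r ^+ (k + i).+1.
  have := @M_eps_combination_le R d alpha B f d0 alpha_gt0 alpha_le1 cf B0 fB
    G (class label k y) (fun=> 1) pt (L * b) (2 ^- (k + i).+1) (2 ^- (k + i)) (k + i)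
    (lexx _) (le_expVn2 (leqnSn _)) (lexx _).
  under eq_bigr do rewrite mul1r; apply => h xi /andP[h1 h2] xi1.
  under eq_bigr do rewrite mul1r.
  apply: (sum_class_second_diff_le alpha_le1 B0 fB _ _ hT').
  have h0 : 0 <= h by apply: le_trans h1; rewrite invr_ge0 exprn_ge0.
  rewrite normrZ ger0_norm//; have := normr_ge0 xi; nra.
have L0 : 0 < L by rewrite exprn_gt0// ltr0n expn_gt0.
rewrite /class_avg card_dyadic_class// normrM [X in _ * X]ger0_norm ?invr_ge0 ?(ltW L0)//.
rewrite ler_pdivrMr//; apply: (le_trans H).
rewrite -mulrA mulrC ler_pM2r//.
have rr1 := dyadic_ratio_le alpha_le1 (k + i) (m - i).
have rr2 := dyadic_ratio_le alpha_le1 (k + i) 0.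
rewrite -hT' in rr1; rewrite addn0 expr0 mulr1 in rr2.
have i2 : 2 ^- i <= r ^+ i by rewrite -exprVn lerXn2r ?nnegrE ?invr_ge0// ltW.
rewrite /b mulrDl; apply: lerD.
  have Q0 : 0 <= 2 * B * (m - i).+1%:R by rewrite !mulr_ge0.
  by have := ler_wpM2l Q0 rr1; rewrite -/r mulrA; lra.
have Q0 : 0 <= 8 * d%:R * B * i.+1%:R by rewrite !mulr_ge0.
apply: (@le_trans _ _ (8 * d%:R * B * i.+1%:R * 2 ^- i * 2)).
  have Q1 : 0 <= 8 * d%:R * B * i.+1%:R * 2 ^- i by rewrite mulr_ge0// invr_ge0 exprn_ge0.
  by have := ler_wpM2l Q1 rr2; rewrite -/r; lra.
by have := ler_wpM2l Q0 i2; lra.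
Qed.

(** The pieces at scales finer than the cube have small means. *)
Lemma class_avg_increment_le k y : (k <= T)%N ->
  `|class_avg label k (fun y' => U T (pt y') - U k (pt y')) y| <= K.
Proof.
move=> kT; pose m := (T - k)%N; have hT : T = (k + m)%N by rewrite subnKC.
have -> : class_avg label k (fun y' => U T (pt y') - U k (pt y')) y =
   \sum_(i < m) class_avg label k (fun y' => U (k + i).+1 (pt y') - U (k + i) (pt y')) y.
  rewrite /class_avg -mulr_suml exchange_big /=; congr (_ / _).
  by apply: eq_bigr => y' _; rewrite [in LHS]hT /U dyadic_M_telescope addrC addKr.
apply: (le_trans (ler_norm_sum _ _ _)).
apply: (le_trans (ler_sum _ (fun i _ => term_le y hT (ltn_ord i)))).
rewrite big_split /= -!mulr_sumr.
have B4 : 0 <= 4 * B by rewrite mulr_ge0.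
have B16 : 0 <= 16 * d%:R * B by rewrite !mulr_ge0.
apply: (le_trans (lerD (ler_wpM2l B4 (arith_geom_rev_sum_le m r01)) (ler_wpM2l B16 (arith_geom_sum_le m r01)))).
have -> : 4 * B * (1 - r) ^- 2 + 16 * d%:R * B * (1 - r) ^- 2 =
    (4 + 16 * d%:R) * (B * (1 - r) ^- 2) by move: ((1 - r) ^- 2) => V; ring.
by apply: le_dyadic_const => //; rewrite -natr1; have := ler0n R d; lra.
Qed.

Lemma class_dist k y y' : (k <= T)%N -> y' \in class label k y ->
  `|pt y' - pt y| <= 2 ^- k.
Proof.
move=> kT; rewrite inE => /eqP/ffunP yy'.
apply: rV_norm_le => [|i]; first by rewrite invr_ge0 exprn_ge0.
have e : (2 ^- T : R) * (2 ^ (T - k))%:R = 2 ^- k.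
  have E : 2 ^+ T = 2 ^+ k * 2 ^+ (T - k) :> R by rewrite -exprD subnKC.
  by rewrite E invfM natrX mulfVK// expf_neq0// pnatr_eq0.
rewrite !mxE -e.
have D0 : 0 < (2 ^- T : R) by rewrite invr_gt0 exprn_gt0.
have := yy' i; rewrite !ffunE; set L := (2 ^ (T - k))%N => q.
have L0 : (0 < L)%N by rewrite expn_gt0.
have y1 : (y i <= y' i + L)%N.
  rewrite (divn_eq (y i) L) -q [X in (_ <= X + _)%N](divn_eq (y' i) L).
  by rewrite -addnA leq_add2l ltnW// ltn_addl// ltn_pmod.
have y2 : (y' i <= y i + L)%N.
  rewrite (divn_eq (y' i) L) q [X in (_ <= X + _)%N](divn_eq (y i) L).
  by rewrite -addnA leq_add2l ltnW// ltn_addl// ltn_pmod.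
move: y1 y2; rewrite -!(ler_nat R) !natrD => y1 y2.
have -> : s0 + 2 ^- T * (y' i)%:R - (s0 + 2 ^- T * (y i)%:R) = 2 ^- T * ((y' i)%:R - (y i)%:R).
  by move: (2 ^- T) => a; ring.
rewrite normrM gtr0_norm// ler_pM2l// ler_norml; lra.
Qed.

(** The pieces finer than the cube average out, and the coarser ones are almost
    constant on it. *)
Lemma grid_martingale_approx k y : (k <= T)%N ->
  `|grid_martingale k y - U k (pt y)| <= 2 * K.
Proof.
move=> kT.
have -> : grid_martingale k y - U k (pt y) =
    class_avg label k (fun y' => U T (pt y') - U k (pt y')) y +
    class_avg label k (fun y' => U k (pt y') + - U k (pt y)) y.
  rewrite [X in _ = _ + X]class_avgD class_avg_cst addrA -class_avgD; congr (_ - _).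
  by apply: eq_class_avg => y' _; rewrite subrK.
rewrite mulr2n mulrDl mul1r (le_trans (ler_normD _ _))// lerD//.
  exact: class_avg_increment_le.
have near y' : y' \in class label k y -> `|U k (pt y') - U k (pt y)| <= K.
  by move=> y'y; apply: dyadic_M_dist_le => //; exact: class_dist.
rewrite ler_norml -[X in X <= _ <= _](class_avg_cst label k _ y) -[X in _ <= _ <= X](class_avg_cst label k _ y).
by apply/andP; split; apply: le_class_avg => y' /near; rewrite ler_norml => /andP[].
Qed.

Lemma grid_martingale_step k y : (k < T)%N ->
  `|grid_martingale k.+1 y - grid_martingale k y| <= 5 * K.
Proof.
move=> kT.
have a1 := grid_martingale_approx y kT.
have a2 := grid_martingale_approx y (ltnW kT).
have a3 : `|U k.+1 (pt y) - U k (pt y)| <= K.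
  apply: (M_eps_osc_le d0 alpha_gt0 alpha_le1 cf B0 fB); rewrite ?lexx//.
  exact: le_expVn2.
move: a1 a2 a3; rewrite !ler_norml => /andP[? ?] /andP[? ?] /andP[? ?].
apply/andP; split; lra.
Qed.

End grid_martingale.

(** * Exceptional sets *)

Lemma ln2_ge_half {R : realType} : 2^-1 <= ln 2 :> R.
Proof.
have := @le_ln1Dx R (- 2^-1); rewrite (_ : 1 - 2^-1 = 2^-1); last lra.
by rewrite lnV ?posrE//; lra.
Qed.

Lemma norm_chain_le {R : realDomainType} (u v w z e a : R) :
  `|u - v| <= e -> `|w - v| <= 2 * e -> `|z| <= 2 * e -> `|w - z| <= a ->
  `|u| <= a + 5 * e.
Proof.
rewrite !ler_norml => /andP[? ?] /andP[? ?] /andP[? ?] /andP[? ?].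
by apply/andP; split; lra.
Qed.

Section exceptional_sets.
Context {R : realType}.
Variables (d : nat) (alpha B : R) (f : 'rV[R]_d -> R).
Hypotheses (d0 : (0 < d)%N) (alpha_gt0 : 0 < alpha) (alpha_le1 : alpha <= 1).
Hypotheses (cf : continuous f) (B0 : 0 <= B) (fB : dyadic_zygmund f B (2^-1 `^ alpha)).
Let U := dyadic_M alpha f.
Let K := dyadic_const d alpha B.
Let K0 : 0 <= K. Proof. exact: dyadic_const_ge0. Qed.

Lemma lebesgue_bigsetU_le (I : finType) (P : {pred I}) (F : I -> set 'rV[R]_d) (b : R) :
  (forall i, measurable (F i)) -> (forall i, lebesgue_rV d (F i) = b%:E) ->
  measurable (\big[setU/set0]_(i in P) F i) /\
  (lebesgue_rV d (\big[setU/set0]_(i in P) F i) <= (#|P|%:R * b)%:E)%E.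
Proof.
move=> mF Fb; rewrite -sum1_card natr_sum mulr_suml -sumEFin.
elim/big_ind2 : _ => [|A e A' e' [mA Ae] [mA' Ae']|i _].
- by rewrite measure0.
- split; first exact: measurableU.
  by apply: (le_trans (measureU2 _ mA mA')); exact: leeD.
- by rewrite mul1r Fb.
Qed.

(** The cells of mesh 2^-T whose corner has a martingale path that moves by a or
    more up to time T; on the other cells the truncations are as small as the
    martingale, up to bounded errors. *)
Lemma exceptional_set (s0 c a l : R) (M T : nat) : 5 * K <= c -> 0 <= l -> l * c <= 2^-1 ->
  exists A : set 'rV[R]_d, [/\ measurable A,
    (lebesgue_rV d A <=
       (2 * M%:R ^+ d * expR (- l * a + 2 * (l * c) ^+ 2 * T%:R))%:E)%E &
    forall x : 'rV[R]_d, (forall i, s0 <= x ord0 i < s0 + M%:R) -> ~ A x ->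
      forall k, (k <= T)%N -> `|U k x| <= a + 5 * K].
Proof.
move=> Kc l0 lc.
pose X := @grid_martingale R d alpha f s0 M T.
pose bad : {pred {ffun 'I_d -> 'I_(M * 2 ^ T)}} :=
  [pred y | has (fun n => a <= `|X n y - X 0 y|) (iota 0 T.+1)].
have D0 : 0 < (2 ^- T : R) by rewrite invr_gt0 exprn_gt0.
have [mA Ale] := @lebesgue_bigsetU_le _ bad (fun y => cell s0 (2 ^- T) y) ((2 ^- T) ^+ d)
  (fun y => measurable_cell _ _ _) (fun y => lebesgue_cell _ D0 y).
exists (\big[setU/set0]_(y in bad) cell s0 (2 ^- T) y); split => //.
  apply: (le_trans Ale); rewrite lee_fin.
  have := @maximal_inequality R _ _ (@dyadic_index d M T) (@dyadic_index_refine d M T) c l T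
    l0 lc (fun y' => U T (@dyadic_point R d s0 M T y')) a.
  move=> H; have {}H := H (fun k y kT =>
    le_trans (grid_martingale_step d0 alpha_gt0 alpha_le1 cf B0 fB s0 y kT) Kc).
  have p0 : 0 <= (2 ^- T : R) ^+ d by rewrite exprn_ge0// ltW.
  apply: (le_trans (ler_wpM2r p0 H)).
  rewrite card_ffun !card_ord natrX natrM natrX exprMn le_eqVlt; apply/orP; left; apply/eqP.
  have e1 : (2 ^+ T) ^+ d * (2 ^- T) ^+ d = 1 :> R.
    by rewrite -exprMn mulfV ?expr1n// expf_neq0// pnatr_eq0.
  rewrite -[RHS]mulr1 -[X in _ = _ * X]e1.
  by move: (expR _) ((2 ^+ T) ^+ d) ((2 ^- T) ^+ d) ((M%:R : R) ^+ d) => E u w m; ring.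
move=> x xQ xA k kT.
have [|y xy] := @cell_ex R d (M * 2 ^ T)%N s0 (2 ^- T) D0 x.
  move=> i; rewrite natrM natrX mulrCA mulVf; first by rewrite mulr1; exact: xQ.
  by rewrite expf_neq0// pnatr_eq0.
have ygood : y \notin bad.
  by apply/negP => yb; apply: xA; rewrite (bigD1 y)//=; left.
have a1 : `|U k x - U k (grid_point s0 (2 ^- T) y)| <= K.
  apply: dyadic_M_dist_le => //; apply: (le_trans (cell_dist D0 xy)); exact: le_expVn2.
have a2 := grid_martingale_approx d0 alpha_gt0 alpha_le1 cf B0 fB s0 y kT.
have a3 := grid_martingale_approx d0 alpha_gt0 alpha_le1 cf B0 fB s0 y (leq0n T).
rewrite dyadic_M0 subr0 in a3.
have a4 : `|X k y - X 0 y| <= a.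
  apply: ltW; move/hasPn : ygood => /(_ k); rewrite mem_iota /= add0n ltnS kT -ltNge.
  by apply.
exact: norm_chain_le a1 a2 a3 a4.
Qed.

End exceptional_sets.

(** Telescoping: (N+4)^-2 <= (N+3)^-1 - (N+4)^-1. *)
Lemma sum_inv_sq_le {R : realType} N :
  \sum_(n < N) (n + 4)%:R ^- 2 <= 3^-1 - (N + 3)%:R^-1 :> R.
Proof.
elim: N => [|N IH]; first by rewrite big_ord0 add0n subrr.
rewrite big_ord_recr /=; apply: (le_trans (lerD IH (lexx _))).
have -> : (N.+1 + 3 = N + 4)%N by rewrite addSn -addnS.
have -> : (N + 4)%:R = (N + 3)%:R + 1 :> R by rewrite natr1 addnS.
set u := (N + 3)%:R : R.
have u0 : 0 < u by rewrite ltr0n addnS.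
have u1 : 0 < u + 1 by lra.
suff : 0 <= u^-1 - (u + 1)^-1 - (u + 1) ^- 2 by lra.
have -> : u^-1 - (u + 1)^-1 - (u + 1) ^- 2 = (u * (u + 1) ^+ 2)^-1.
  by field; rewrite !gt_eqF.
by rewrite invr_ge0 mulr_ge0 ?exprn_ge0 ?ltW.
Qed.

Section almost_everywhere_bound.
Context {R : realType}.
Variables (d : nat) (alpha B : R) (f : 'rV[R]_d -> R).
Hypotheses (d0 : (0 < d)%N) (alpha_gt0 : 0 < alpha) (alpha_le1 : alpha <= 1).
Hypotheses (cf : continuous f) (B0 : 0 <= B) (fB : dyadic_zygmund f B (2^-1 `^ alpha)).
Let U := dyadic_M alpha f.
Let K := dyadic_const d alpha B.
Let K0 : 0 <= K. Proof. exact: dyadic_const_ge0. Qed.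
Let c := 5 * K + 1.

(** Up to a constant, a level that a martingale with bounded increments exceeds
    within 2^j steps with probability O(j^-2). *)
Definition block_bound (j : nat) : R := Num.sqrt (2 ^+ j * ln j%:R).

Lemma ln_natr_le_expn2 j : (4 <= j)%N -> 4 * ln j%:R <= 2 ^+ j :> R.
Proof.
move=> j4; have : ln j%:R <= j%:R - 1 :> R.
  rewrite -[X in ln X](subrK 1) addrC; apply: le_ln1Dx.
  by rewrite ltrBrDr addNr ltr0n; lia.
have : (4 * (j - 1) <= 2 ^ j)%N.
  elim: j j4 => // j IH; rewrite leq_eqVlt => /predU1P[<-//|]; rewrite ltnS => j4.
  have : (4 <= 2 ^ j)%N by rewrite -[4%N]/(2 ^ 2)%N leq_exp2l//; lia.
  rewrite expnS; move: (IH j4); set p := (2 ^ j)%N; lia.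
by rewrite -(ler_nat R) natrM natrX natrB; [lra|lia].
Qed.

(** With sigma^2 = ln j / 2^j, the choice l = sigma / c at the level
    a = 4 c sigma 2^j makes the exponent -4 sigma^2 2^j + 2 sigma^2 2^j = -2 ln j.
    The index j = n + 4 guarantees sigma <= 1/2. *)
Lemma block_exceptional_set (s0 : R) (M n : nat) :
  exists A : set 'rV[R]_d, [/\ measurable A,
    (lebesgue_rV d A <= (2 * M%:R ^+ d * (n + 4)%:R ^- 2)%:E)%E &
    forall x : 'rV[R]_d, (forall i, s0 <= x ord0 i < s0 + M%:R) -> ~ A x ->
      forall k, (k <= 2 ^ (n + 4))%N ->
        `|U k x| <= 4 * c * block_bound (n + 4) + 5 * K].
Proof.
set j := (n + 4)%N.
have j4 : (4 <= j)%N by rewrite leq_addl.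
have j0 : 0 < j%:R :> R by rewrite ltr0n; lia.
pose sigma := Num.sqrt (ln j%:R / 2 ^+ j) : R.
have lnj : 0 <= ln j%:R :> R by rewrite ln_ge0// ler1n; lia.
have p0 : 0 < 2 ^+ j :> R by rewrite exprn_gt0.
have s2 : sigma ^+ 2 = ln j%:R / 2 ^+ j by rewrite sqr_sqrtr// divr_ge0// ltW.
have s0' : 0 <= sigma by exact: sqrtr_ge0.
have shalf : sigma <= 2^-1.
  rewrite -(@ler_pXn2r _ 2)// ?nnegrE ?invr_ge0// s2 ler_pdivrMr//.
  by have := ln_natr_le_expn2 j4; lra.
have sT : sigma * 2 ^+ j = block_bound j.
  rewrite /block_bound -[LHS]ger0_norm ?mulr_ge0 ?(ltW p0)// -sqrtr_sqr; congr Num.sqrt.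
  by rewrite exprMn s2 [_ ^+ 2]expr2 mulrA mulfVK ?gt_eqF// mulrC.
have c0 : 0 < c by rewrite /c ltr_wpDl// mulr_ge0.
have lc : sigma / c * c <= 2^-1 by rewrite divfK ?gt_eqF.
have Kc : 5 * K <= c by rewrite /c lerDl.
have [A [mA Ale AP]] := exceptional_set d0 alpha_gt0 alpha_le1 cf B0 fB s0
  (4 * c * block_bound j) M (2 ^ j) Kc (divr_ge0 s0' (ltW c0)) lc.
exists A; split => //; apply: (le_trans Ale).
rewrite lee_fin ler_wpM2l ?mulr_ge0 ?exprn_ge0//.
have -> : - (sigma / c) * (4 * c * block_bound j) + 2 * (sigma / c * c) ^+ 2 * (2 ^ j)%:R =
    - (2 * ln j%:R).
  rewrite divfK ?gt_eqF// s2 natrX -sT.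
  have -> : - (sigma / c) * (4 * c * (sigma * 2 ^+ j)) = - 4 * sigma ^+ 2 * 2 ^+ j.
    by field; rewrite gt_eqF.
  by rewrite s2; field; rewrite gt_eqF.
by rewrite expRN mulr_natl -lnXn// lnK// posrE exprn_gt0.
Qed.

Lemma ae_block_bound : {ae @lebesgue_rV R d, forall x : 'rV[R]_d,
  exists n0, forall n, (n0 <= n)%N -> forall k, (k <= 2 ^ (n + 4))%N ->
    `|U k x| <= 4 * c * block_bound (n + 4) + 5 * K}.
Proof.
have /choice [A AP] : forall m, exists A : nat -> set 'rV[R]_d, forall n, [/\ measurable (A n),
    (lebesgue_rV d (A n) <= (2 * (2 * m)%:R ^+ d * (n + 4)%:R ^- 2)%:E)%E &
    forall x : 'rV[R]_d, (forall i, - m%:R <= x ord0 i < - m%:R + (2 * m)%:R) -> ~ A n x ->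
      forall k, (k <= 2 ^ (n + 4))%N ->
        `|U k x| <= 4 * c * block_bound (n + 4) + 5 * K].
  by move=> m; have [A AP] := choice (block_exceptional_set (- m%:R) (2 * m)); exists A.
have negl m : (lebesgue_rV d).-negligible (lim_sup_set (A m)).
  apply/negligibleP.
    apply: bigcap_measurable => // k _; apply: bigcup_measurable => n _.
    by have [] := AP m n.
  apply: lim_sup_set_cvg0 => [n|]; first by have [] := AP m n.
  apply: (@le_lt_trans _ _ (2 * (2 * m)%:R ^+ d * 3^-1)%:E); last exact: ltry.
  apply: lime_le; first by apply: is_cvg_nneseries.
  apply: nearW => N; rewrite big_mkord.
  apply: (@le_trans _ _ (\sum_(n < N) (2 * (2 * m)%:R ^+ d * (n + 4)%:R ^- 2)%:E)%E).
    by apply: lee_sum => n _; have [] := AP m n.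
  rewrite sumEFin lee_fin -mulr_sumr ler_wpM2l ?mulr_ge0 ?exprn_ge0//.
  apply: (le_trans (sum_inv_sq_le N)).
  by rewrite gerBl invr_ge0.
apply: negligibleS (negligible_bigcup negl) => x nx.
pose m := (Num.truncn `|x|).+1.
exists m => //=; apply: contrapT => nlim; apply: nx => /=.
have [n0 Hn0] : exists n0, forall n, (n0 <= n)%N -> ~ A m n x.
  apply: contrapT => Hn; apply: nlim => n0 _; apply: contrapT => Hn0; apply: Hn.
  by exists n0 => n n0n Ax; apply: Hn0; exists n.
exists n0 => n n0n k kn.
have [_ _ /(_ x)] := AP m n; apply => //; last exact: Hn0.
move=> i; have : `|x ord0 i| < m%:R by apply: le_lt_trans (coord_le_rV_norm x i) (truncnS_gt _).
by rewrite ltr_norml natrM; move=> /andP[? ?]; apply/andP; split; lra.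
Qed.

End almost_everywhere_bound.

(** * The law of the iterated logarithm *)

Section iterated_logarithm.
Context {R : realType}.

(** For t = 7 on, the logarithm of 2^t ln 2 is at least (t-1)/2, and
    ((t-1)/2)^2 >= t+1. *)
Lemma half_ln_natr_le (t : nat) : (7 <= t)%N ->
  2^-1 * ln t.+1%:R <= ln (ln (2 ^+ t * ln 2)) :> R.
Proof.
move=> t7.
have t7' : 7 <= t%:R :> R by rewrite (ler_nat R 7).
have ln2 := @ln2_ge_half R.
have ln20 : 0 < ln 2 :> R by lra.
have p0 : 0 < 2 ^+ t :> R by rewrite exprn_gt0.
have low : (t%:R - 1) / 2 <= ln (2 ^+ t * ln 2) :> R.
  apply: (@le_trans _ _ (ln (2 ^+ t.-1) : R)).
    have E : t.-1%:R = t%:R - 1 :> R by rewrite -[in RHS](ltn_predK t7) -natr1 addrK.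
    by rewrite lnXn// -[leRHS]mulr_natl E ler_wpM2l//; lra.
  rewrite ler_ln ?posrE ?exprn_gt0 ?mulr_gt0// -[X in _ <= 2 ^+ X * _](ltn_predK t7) exprS.
  have q0 : 0 < 2 ^+ t.-1 :> R by rewrite exprn_gt0.
  have := ler_wpM2l (ltW q0) ln2; lra.
have t1 : 0 < (t%:R - 1) / 2 :> R by lra.
apply: (@le_trans _ _ (ln ((t%:R - 1) / 2) : R)); last first.
  by rewrite ler_ln ?posrE//; exact: lt_le_trans low.
have : ln t.+1%:R <= 2 * ln ((t%:R - 1) / 2) :> R.
  rewrite mulr_natl -lnXn// ler_ln ?posrE ?exprn_gt0// -natr1; nra.
lra.
Qed.

Lemma dyadic_scale (e : R) : 0 < e < 1 -> exists n : nat, 2 ^- n.+1 <= e < 2 ^- n.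
Proof.
move=> /andP[e0 e1].
have ex : exists p : nat, 2 ^- p <= e.
  exists (Num.truncn e^-1).+1.
  rewrite invf_ple ?posrE ?exprn_gt0// (le_trans (ltW (truncnS_gt _)))//.
  by rewrite -natrX ler_nat ltnW// ltn_expl.
case: (ex_minnP ex) => -[|n] pe pmin; first by move: pe; rewrite expr0 invr1 leNgt e1.
exists n; rewrite pe /= ltNge; apply/negP => /pmin; by rewrite ltnn.
Qed.

End iterated_logarithm.

Section limsup_bound.
Context {R : realType}.
Variables (d : nat) (alpha B : R) (f : 'rV[R]_d -> R).
Hypotheses (d0 : (0 < d)%N) (alpha_gt0 : 0 < alpha) (alpha_le1 : alpha <= 1).
Hypotheses (cf : continuous f) (B0 : 0 <= B) (fB : dyadic_zygmund f B (2^-1 `^ alpha)).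
Let K := dyadic_const d alpha B.
Let K0 : 0 <= K. Proof. exact: dyadic_const_ge0. Qed.

(** 4 (5 K + 1) is the constant of the block bound, 6 K collects the bounded errors,
    and 3 compares the block bound with the normalisation. *)
Definition lil_const : R := 3 * (4 * (5 * K + 1) + 6 * K).

Lemma lil_const_gt0 : 0 < lil_const.
Proof.
have K5 : 0 <= 5 * K by rewrite mulr_ge0.
have K6 : 0 <= 6 * K by rewrite mulr_ge0.
by rewrite /lil_const; lra.
Qed.

(** With 2^t <= n < 2^(t+1) and 2^-(n+1) <= e < 2^-n, one has ln(1/e) >= 2^(t-1)
    and ln ln ln(1/e) >= ln(t+1) / 2, so that the normalisation is at least one
    third of the block bound of index t+1. *)
Lemma M_eps_le_of_block_bound (n0 : nat) (x : 'rV[R]_d) :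
  (forall n, (n0 <= n)%N -> forall k, (k <= 2 ^ (n + 4))%N ->
    `|dyadic_M alpha f k x| <= 4 * (5 * K + 1) * block_bound (n + 4) + 5 * K) ->
  forall e, 0 < e < 2 ^- (2 ^ (n0 + 8)) ->
    `|M_eps alpha e f x| / Num.sqrt (ln (e^-1) * ln (ln (ln (e^-1)))) <= lil_const.
Proof.
move=> Hn e /andP[e0 ed].
have p1 : (2 ^- (2 ^ (n0 + 8)) : R) <= 1 by rewrite -[leRHS]invr1 -(expr0 2); exact: le_expVn2.
have [|n /andP[ne en]] := @dyadic_scale R e; first by rewrite e0 (lt_le_trans ed).
have nn0 : (2 ^ (n0 + 8) <= n)%N.
  rewrite -ltnS ltnNge; apply/negP => np.
  by have := le_trans (le_expVn2 np) ne; rewrite leNgt ed.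
have n_gt0 : (0 < n)%N by apply: leq_trans nn0; rewrite expn_gt0.
pose t := trunc_log 2 n.
have [tn nt] : (2 ^ t <= n)%N /\ (n < 2 ^ t.+1)%N.
  by have /andP[] := trunc_log_bounds (isT : 1 < 2)%N n_gt0.
have t8 : (n0 + 8 <= t)%N by rewrite trunc_log_max.
have t7 : (7 <= t)%N by rewrite (leq_trans _ t8)// (leq_trans _ (leq_addl n0 8)).
have U1 : `|dyadic_M alpha f n x| <= 4 * (5 * K + 1) * block_bound t.+1 + 5 * K.
  have t4 : (4 <= t.+1)%N by rewrite ltnS (leq_trans _ t7).
  have := Hn (t.+1 - 4)%N; rewrite subnK//; apply; last exact: ltnW.
  by rewrite leq_subRL// addnC (leq_trans _ (leqW t8))// leq_add2l.
have U2 : `|M_eps alpha e f x - dyadic_M alpha f n x| <= K.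
  exact: (M_eps_osc_le d0 alpha_gt0 alpha_le1 cf B0 fB x ne (ltW en) (lexx _)).
set Q := block_bound t.+1 in U1 *.
have ln2 := @ln2_ge_half R.
have lnt : 2^-1 <= ln t.+1%:R :> R.
  by apply: le_trans ln2 _; rewrite ler_ln ?posrE ?ltr0n// ler_nat ltnS (leq_trans _ t7).
have Q2 : Q ^+ 2 = 2 ^+ t.+1 * ln t.+1%:R.
  by rewrite sqr_sqrtr// mulr_ge0 ?exprn_ge0//; lra.
have tp1 : 1 <= 2 ^+ t :> R by rewrite exprn_ege1// ler1n.
have Q1 : 1 <= Q.
  rewrite -[leLHS]sqrtr1 ler_wsqrtr// exprS; nra.
have Lge : 2 ^+ t * ln 2 <= ln e^-1 :> R.
  have ne' : (2 ^+ n : R) <= e^-1.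
    by rewrite -[leLHS]invrK lef_pV2 ?posrE ?invr_gt0 ?exprn_gt0// ltW.
  apply: (@le_trans _ _ (ln (2 ^+ n) : R)); last first.
    by rewrite ler_ln ?posrE ?invr_gt0 ?exprn_gt0.
  rewrite lnXn// -[leRHS]mulr_natl ler_wpM2r//; first lra.
  by rewrite -natrX ler_nat.
have l0 : 0 < 2 ^+ t * ln 2 :> R by rewrite mulr_gt0 ?exprn_gt0//; lra.
have LLL : 2^-1 * ln t.+1%:R <= ln (ln (ln e^-1)).
  apply: (le_trans (half_ln_natr_le t7)).
  have big : 1 < 2 ^+ t * ln 2 :> R.
    have : 2 ^+ 2 <= 2 ^+ t :> R by rewrite ler_weXn2l ?ler1n// (leq_trans _ t7).
    by move: ln2 l0; rewrite expr2; move: (2 ^+ t) (ln 2) => u v; nra.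
  have lbig := ln_gt0 big.
  have lle : ln (2 ^+ t * ln 2) <= ln (ln e^-1) by rewrite ler_ln ?posrE// (lt_le_trans l0).
  by rewrite ler_ln ?posrE// (lt_le_trans lbig).
have sq : Q / 3 <= Num.sqrt (ln e^-1 * ln (ln (ln e^-1))).
  rewrite -[leLHS]ger0_norm ?divr_ge0 ?(le_trans ler01 Q1)// -sqrtr_sqr ler_wsqrtr//.
  rewrite exprMn Q2 exprS.
  have h1 : 2 ^+ t * 2^-1 <= ln e^-1 by apply: le_trans Lge; rewrite ler_wpM2l ?exprn_ge0.
  have a1 : 0 <= 2 ^+ t * 2^-1 :> R by lra.
  have a2 : 0 <= 2^-1 * ln t.+1%:R :> R by lra.
  by apply: le_trans (ler_pM a1 a2 h1 LLL); nra.
have s0 : 0 < Num.sqrt (ln e^-1 * ln (ln (ln e^-1))) by apply: lt_le_trans sq; lra.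
rewrite ler_pdivrMr//.
have C0 := lil_const_gt0.
apply: (@le_trans _ _ (lil_const * (Q / 3))); last by rewrite ler_wpM2l// ltW.
have MQ : `|M_eps alpha e f x| <= 4 * (5 * K + 1) * Q + 6 * K.
  rewrite -(subrK (dyadic_M alpha f n x) (M_eps alpha e f x)).
  by apply: (le_trans (ler_normD _ _)); have := lerD U2 U1; lra.
apply: (le_trans MQ); rewrite /lil_const.
have : 6 * K * 1 <= 6 * K * Q by rewrite ler_wpM2l// mulr_ge0.
lra.
Qed.

Lemma limf_esup_le_of_block_bound (x : 'rV[R]_d) :
  (exists n0, forall n, (n0 <= n)%N -> forall k, (k <= 2 ^ (n + 4))%N ->
    `|dyadic_M alpha f k x| <= 4 * (5 * K + 1) * block_bound (n + 4) + 5 * K) ->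
  (limf_esup (fun eps : R =>
            (`|M_eps alpha eps f x| /
             Num.sqrt (ln (eps^-1) * ln (ln (ln (eps^-1)))))%:E)
          (0 : R)^'+ <= lil_const%:E)%E.
Proof.
move=> [n0 Hn]; pose delta : R := 2 ^- (2 ^ (n0 + 8)).
have delta0 : 0 < delta by rewrite invr_gt0 exprn_gt0.
rewrite limf_esupE; apply: ereal_inf_le.
exists (ereal_sup [set (`|M_eps alpha eps f x| /
             Num.sqrt (ln (eps^-1) * ln (ln (ln (eps^-1)))))%:E | eps in `]0, delta[ ]).
  exists `]0, delta[%classic => //.
  have : \forall e \near (0 : R)^'+, e \in `]0, delta[.
    near=> e; rewrite in_itv /=; apply/andP; split; near: e.
      exact: nbhs_right_gt.
    exact: nbhs_right_lt.
  by [].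
apply: ge_ereal_sup => z [e /=]; rewrite in_itv /= => ed <-.
by rewrite lee_fin; exact: M_eps_le_of_block_bound ed.
Unshelve. all: by end_near.
Qed.

End limsup_bound.

(** The Hoelder and the Zygmund conditions both give the dyadic second difference
    bound with r = 2^-alpha, with constants that depend on d and N only. *)
Section Lambda_dyadic.
Context {R : realType}.
Variables (d : nat) (alpha N : R) (f : 'rV[R]_d -> R).
Hypotheses (d0 : (0 < d)%N) (alpha_gt0 : 0 < alpha) (alpha_le1 : alpha <= 1).
Hypotheses (fL : Lambda alpha f) (fN : Lambda_seminorm alpha f = N%:E).
Let r : R := 2^-1 `^ alpha.

Lemma enorm_le_norm (h : 'rV[R]_d) : enorm h <= d%:R * `|h|.
Proof.
rewrite -[leRHS]ger0_norm ?mulr_ge0// -sqrtr_sqr ler_wsqrtr//.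
apply: (@le_trans _ _ (\sum_(i < d) `|h| ^+ 2)).
  apply: ler_sum => i _; rewrite -real_normK ?num_real// lerXn2r ?nnegrE//.
  exact: coord_le_rV_norm.
rewrite sumr_const card_ord -[leLHS]mulr_natl exprMn ler_wpM2r ?exprn_ge0//.
by rewrite -natrX ler_nat expnS expn1 leq_pmulr.
Qed.

Lemma enorm_powR_le n (h : 'rV[R]_d) : `|h| <= 4 * 2 ^- n ->
  enorm h `^ alpha <= 4 * d%:R * r ^+ n.
Proof.
move=> hn.
have d1 : 1 <= 4 * d%:R :> R by rewrite -natrM ler1n muln_gt0.
have h1 : enorm h <= 4 * d%:R * 2 ^- n.
  apply: (le_trans (enorm_le_norm h)).
  by have := ler_wpM2l (ler0n R d) hn; lra.
have p0 : 0 <= (2 ^- n : R) by rewrite invr_ge0 exprn_ge0.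
apply: (@le_trans _ _ ((4 * d%:R * 2 ^- n) `^ alpha)).
  by apply: ge0_ler_powR; rewrite ?nnegrE ?sqrtr_ge0 ?mulr_ge0// ltW.
rewrite powRM ?mulr_ge0//; apply: ler_pM; rewrite ?powR_ge0//.
  by rewrite ler1_powR.
by rewrite -exprVn -[X in X `^ _]powR_mulrn ?invr_ge0// powRAC powR_mulrn// powR_ge0.
Qed.

Lemma enorm_gt0 (h : 'rV[R]_d) : h != 0 -> 0 < enorm h.
Proof.
move=> h0; rewrite lt_neqAle sqrtr_ge0 andbT; apply/eqP => e.
case/eqP: h0; apply/rowP => i; rewrite mxE; apply/eqP; rewrite -normr_le0 e.
exact: enorm_coord.
Qed.

Lemma holder_increment_le x h : alpha != 1 ->
  `|f (x + h) - f x| <= `|N| * enorm h `^ alpha.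
Proof.
move=> /negPf a1; have [->|h0] := eqVneq h 0.
  by rewrite addr0 subrr normr0 mulr_ge0// powR_ge0.
have hp : 0 < enorm h `^ alpha by rewrite powR_gt0// enorm_gt0.
rewrite -ler_pdivrMr//; apply: le_trans (ler_norm N).
rewrite -lee_fin -fN /Lambda_seminorm a1; apply: ereal_sup_ubound.
by exists x => //; exists h.
Qed.

Lemma zygmund_second_diff_le x h : alpha = 1 ->
  `|second_diff f h x| <= `|N| * enorm h `^ alpha.
Proof.
move=> a1; have [->|h0] := eqVneq h 0.
  by rewrite /second_diff addr0 subr0 (_ : f x + f x - 2 * f x = 0) ?normr0 ?mulr_ge0 ?powR_ge0//; ring.
rewrite a1 powRr1 ?sqrtr_ge0// -ler_pdivrMr ?enorm_gt0//; apply: le_trans (ler_norm N).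
rewrite -lee_fin -fN /Lambda_seminorm a1 eqxx; apply: ereal_sup_ubound.
by exists x => //; exists h.
Qed.

Lemma Lambda_dyadic_zygmund : dyadic_zygmund f (8 * d%:R * `|N|) r.
Proof.
move=> n x h hn; have hp := enorm_powR_le hn.
have hp0 : 0 <= enorm h `^ alpha by rewrite powR_ge0.
have := ler_wpM2l (normr_ge0 N) hp => Nh.
have [a1|a1] := eqVneq alpha 1.
  apply: (le_trans (zygmund_second_diff_le x h a1)).
  have : 0 <= `|N| * enorm h `^ alpha by rewrite mulr_ge0.
  move: Nh; lra.
have -> : second_diff f h x = (f (x + h) - f x) + (f (x + - h) - f x).
  by rewrite /second_diff; ring.
apply: (le_trans (ler_normD _ _)).
have := holder_increment_le x h a1; have := holder_increment_le x (- h) a1.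
rewrite enorm_opp; move: Nh; lra.
Qed.

Lemma Lambda_continuous : continuous f.
Proof.
have [a1|a1] := eqVneq alpha 1; first by case: fL => /(_ a1).
apply: continuous_of_modulus => x e e0.
have r01 : 0 <= r < 1 by rewrite (ltW (half_powR_gt0 _)) half_powR_lt1.
pose A := `|N| * (4 * d%:R) + 1.
have A0 : 0 < A by rewrite ltr_wpDl// !mulr_ge0.
have /cvgrPdist_lt /(_ (e / A)) := cvg_arith_geom r01.
rewrite divr_gt0// => /(_ erefl) [m _ /(_ m (leqnn m))] /=.
rewrite sub0r normrN ltr_pdivlMr// => He.
exists (2 ^- m) => [|y xy]; first by rewrite invr_gt0 exprn_gt0.
have hy : `|y - x| <= 4 * 2 ^- m.
  rewrite distrC (le_trans xy)//.
  have : 0 < (2 ^- m : R) by rewrite invr_gt0 exprn_gt0.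
  lra.
have rm0 : 0 <= r ^+ m by rewrite exprn_ge0//; case/andP: r01.
have := holder_increment_le x (y - x) a1.
rewrite [x + _]addrC subrK distrC => /le_trans; apply.
apply: (le_trans (ler_wpM2l (normr_ge0 N) (enorm_powR_le hy))).
apply: le_trans (ltW He); rewrite [X in _ <= X * _]ger0_norm ?mulr_ge0//.
have r1m : r ^+ m <= m.+1%:R * r ^+ m by rewrite ler_peMl// ler1n.
have NN : 0 <= `|N| * (4 * d%:R) by rewrite !mulr_ge0.
have := ler_wpM2l NN r1m; have : 0 <= m.+1%:R * r ^+ m by rewrite mulr_ge0.
rewrite /A; lra.
Qed.

End Lambda_dyadic.

Theorem corollary1p3 (R : realType) (d : nat) (alpha N : R)
    (d_gt0 : (0 < d)%N) (alpha_gt0 : 0 < alpha) (alpha_le1 : alpha <= 1) :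
  exists2 C : R, 0 < C &
    forall f : 'rV[R]_d -> R,
      Lambda alpha f -> Lambda_seminorm alpha f = N%:E ->
      {ae @lebesgue_rV R d, forall x : 'rV[R]_d,
        (limf_esup (fun eps : R =>
            (`|M_eps alpha eps f x| /
             Num.sqrt (ln (eps^-1) * ln (ln (ln (eps^-1)))))%:E)
          (0 : R)^'+ <= C%:E)%E}.
Proof.
have B0 : 0 <= 8 * d%:R * `|N| by rewrite !mulr_ge0.
exists (lil_const d alpha (8 * d%:R * `|N|)); first exact: lil_const_gt0.
move=> f fL fN.
have cf := Lambda_continuous d_gt0 alpha_gt0 alpha_le1 fL fN.
have fB := Lambda_dyadic_zygmund d_gt0 alpha_gt0 alpha_le1 fN.
apply: filterS (ae_block_bound d_gt0 alpha_gt0 alpha_le1 cf B0 fB) => x.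
exact: limf_esup_le_of_block_bound.
Qed.
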